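(* Let $\alpha$ be a real algebraic number that is irrational and not quadratic. Then $\exists^{k}\forall^{k}\exists^{k}\forall^{k}$ $\alpha$-PA sentences are undecidable, where $k = 20000$; that is, there is no algorithm which, given such a sentence, determines whether it is true.
   Context: For a real number $\alpha$, an $\alpha$-PA sentence ($\alpha$-Presburger sentence) is a statement $Q_1 \mathbf{x}_1 \in \mathbb{Z}^{n_1} \dots Q_r \mathbf{x}_r \in \mathbb{Z}^{n_r}\ \Phi(\mathbf{x}_1,\dots,\mathbf{x}_r)$, where $Q_1,\dots,Q_r \in \{\forall,\exists\}$ are $r$ alternating quantifiers, $\mathbf{x}_1,\dots,\mathbf{x}_r$ are blocks of integer variables, and $\Phi$ is a Boolean combination of linear inequalities in $\mathbf{x}_1,\dots,\mathbf{x}_r$ with coefficients and constant terms in $\mathbb{Z}[\alpha]$. An $\exists^{k}\forall^{k}\exists^{k}\forall^{k}$ sentence is one with four quantifier blocks $\exists,\forall,\exists,\forall$, each having $k$ integer variables. A real algebraic number $\alpha$ of degree $d$ is given by its defining $\mathbb{Z}[x]$-polynomial of degree $d$ together with a rational interval singling out a unique root; it is quadratic if $d=2$. Elements of $\mathbb{Z}[\alpha]$ are represented as $c_0 + c_1\alpha + \dots + c_{d-1}\alpha^{d-1}$ with $c_i \in \mathbb{Z}$. *)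

(* Defs.v *)
From HB Require Import structures.
From mathcomp Require Import all_boot all_order all_algebra.
From mathcomp Require Import boolp reals.
Set Implicit Arguments.
Unset Strict Implicit.
Unset Printing Implicit Defensive.
Import Order.TTheory GRing.Theory Num.Theory.
Local Open Scope ring_scope.

Definition algebraic_of_degree (R : realType) (alpha : R) (d : nat) : Prop :=
  exists p : {poly int},
    [/\ size p = d.+1,
        irreducible_poly (map_poly (intr : int -> rat) p)
      & root (map_poly (intr : int -> R) p) alpha].

Definition quadratic (R : realType) (alpha : R) : Prop :=
  algebraic_of_degree alpha 2.

(* The tuple (c_0, ..., c_(d-1)) stands for c_0 + c_1 alpha + ... +
   c_(d-1) alpha^(d-1). *)
Definition zalpha (d : nat) : Type := d.-tuple int.

Definition zalpha_val (R : realType) (alpha : R) d (c : zalpha d) : R :=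
  \sum_(i < d) (tnth c i)%:~R * alpha ^+ i.

(* The linear form a_1 x_1 + ... + a_n x_n + b, given as (a, b). *)
Definition linform (d n : nat) : Type := (n.-tuple (zalpha d) * zalpha d)%type.

Definition linform_val (R : realType) (alpha : R) d n
    (l : linform d n) (x : 'rV[int]_n) : R :=
  \sum_(j < n) zalpha_val alpha (tnth l.1 j) * (x 0 j)%:~R
    + zalpha_val alpha l.2.

(* The atoms [Ge0 l] and [Gt0 l] are the inequalities l >= 0 and l > 0. *)
Inductive formula (d n : nat) : Type :=
  | Ge0 of linform d n
  | Gt0 of linform d n
  | Not of formula d n
  | And of formula d n & formula d n
  | Or of formula d n & formula d n.

Fixpoint formula_holds (R : realType) (alpha : R) d n
    (phi : formula d n) (x : 'rV[int]_n) : Prop :=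
  match phi with
  | Ge0 l => 0 <= linform_val alpha l x
  | Gt0 l => 0 < linform_val alpha l x
  | Not f => ~ formula_holds alpha f x
  | And f g => formula_holds alpha f x /\ formula_holds alpha g x
  | Or f g => formula_holds alpha f x \/ formula_holds alpha g x
  end.

Inductive quantifier := Forall | Exists.

Definition dual (q : quantifier) : quantifier :=
  if q is Forall then Exists else Forall.

(* [quantify q [:: n_1; ...; n_r] P] is
   Q_1 x_1 in Z^(n_1) ... Q_r x_r in Z^(n_r), P (x_1, ..., x_r)
   where Q_1 = q and the quantifiers alternate. *)
Fixpoint quantify (q : quantifier) (ns : seq nat) :
    ('rV[int]_(sumn ns) -> Prop) -> Prop :=
  match ns return ('rV[int]_(sumn ns) -> Prop) -> Prop with
  | [::] => fun P => P 0
  | n :: ns' => fun P =>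
      let rest (x : 'rV[int]_n) :=
        @quantify (dual q) ns' (fun y => P (row_mx x y)) in
      match q with
      | Forall => forall x, rest x
      | Exists => exists x, rest x
      end
  end.

Definition PA_true (R : realType) (alpha : R) (d : nat)
    (q : quantifier) (ns : seq nat) (phi : formula d (sumn ns)) : Prop :=
  @quantify q ns (formula_holds alpha phi).

(* An E^k A^k E^k A^k sentence is determined by its matrix. *)
Definition EAEA_sentence (d k : nat) : Type := formula d (sumn (nseq 4 k)).

Definition EAEA_true (R : realType) (alpha : R) (d k : nat)
    (phi : EAEA_sentence d k) : Prop :=
  @PA_true R alpha d Exists (nseq 4 k) phi.

(* [CodeSeq.code] is the computable bijection from [seq nat] to [nat] sending
   [:: a_1; ...; a_m] to 2^a_1 (1 + 2 (2^a_2 (1 + 2 (...)))). *)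

Definition code_int (z : int) : nat :=
  match z with Posz m => m.*2 | Negz m => m.*2.+1 end.

Definition code_zalpha d (c : zalpha d) : nat :=
  CodeSeq.code (map code_int c).

Definition code_linform d n (l : linform d n) : nat :=
  CodeSeq.code (code_zalpha l.2 :: map (@code_zalpha d) l.1).

Fixpoint code_formula d n (phi : formula d n) : nat :=
  match phi with
  | Ge0 l => CodeSeq.code [:: 0; code_linform l]
  | Gt0 l => CodeSeq.code [:: 1; code_linform l]
  | Not f => CodeSeq.code [:: 2; code_formula f]
  | And f g => CodeSeq.code [:: 3; code_formula f; code_formula g]
  | Or f g => CodeSeq.code [:: 4; code_formula f; code_formula g]
  end%N.

Lemma code_int_inj : injective code_int.
Proof.
case=> m [] n /= /[dup] /(congr1 odd); rewrite /= !odd_double //= => _.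
  by move/double_inj=> ->.
by case=> /double_inj ->.
Qed.

Lemma code_zalpha_inj d : injective (@code_zalpha d).
Proof.
move=> c c' /(can_inj CodeSeq.codeK) /(inj_map code_int_inj) e.
exact: val_inj.
Qed.

Lemma code_linform_inj d n : injective (@code_linform d n).
Proof.
move=> [a b] [a' b'] /(can_inj CodeSeq.codeK) [/code_zalpha_inj -> e].
congr pair; apply: val_inj; exact: (inj_map (@code_zalpha_inj d)) e.
Qed.

Lemma code_formula_inj d n : injective (@code_formula d n).
Proof.
have inj : injective CodeSeq.code := can_inj CodeSeq.codeK.
elim=> [l|l|f IHf|f IHf g IHg|f IHf g IHg] [l'|l'|f'|f' g'|f' g'] //
  => /inj [] //.
- by move/code_linform_inj->.
- by move/code_linform_inj->.
- by move/IHf->.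
- by move=> /IHf-> /IHg->.
- by move=> /IHf-> /IHg->.
Qed.

Definition code_EAEA (d k : nat) (phi : EAEA_sentence d k) : nat :=
  @code_formula d (sumn (nseq 4 k)) phi.

Inductive recfun : nat -> Type :=
  | Zero : recfun 0
  | Succ : recfun 1
  | Proj n (i : 'I_n) : recfun n
  | Comp m n (f : recfun m) (g : 'I_m -> recfun n) : recfun n
  | PrimRec n (f : recfun n) (g : recfun n.+2) : recfun n.+1
  | Mu n (f : recfun n.+1) : recfun n.

(* [computes f v y]: f is defined at v, with value y.  In [PrimRec f g] the
   recursion is on the first argument, and [g] takes the current index, the
   previous value, and the parameters, in this order.  [Mu f] minimizes over
   the first argument of f and requires f to be defined up to the minimum. *)
Fixpoint computes n (f : recfun n) : n.-tuple nat -> nat -> Prop :=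
  match f in recfun n return n.-tuple nat -> nat -> Prop with
  | Zero => fun _ y => y = 0%N
  | Succ => fun v y => y = (thead v).+1
  | Proj _ i => fun v y => y = tnth v i
  | @Comp m n f g => fun v y => exists w : m.-tuple nat,
      (forall i, computes (g i) v (tnth w i)) /\ computes f w y
  | @PrimRec n f g => fun v y =>
      let params := [tuple of behead v] in
      (fix iterate (t : nat) (z : nat) : Prop :=
         match t with
         | 0%N => computes f params z
         | t'.+1 => exists z', iterate t' z' /\
             computes g [tuple of t' :: z' :: params] z
         end) (thead v) y
  | @Mu n f => fun v y =>
      computes f [tuple of y :: v] 0%N /\
      (forall t, (t < y)%N -> exists z, computes f [tuple of t :: v] z.+1)
  end.

(* Instances of the problem [P] are presented to the algorithm through their
   Goedel numbers; the answer is 1 for yes and 0 for no. *)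
Definition algorithmically_decidable (T : Type) (code : T -> nat)
    (P : T -> Prop) : Prop :=
  exists f : recfun 1, forall x : T,
    (P x -> computes f [tuple code x] 1%N) /\
    (~ P x -> computes f [tuple code x] 0%N).

(* Main.v *)
(* Write b = alpha^2. Since alpha is neither rational nor quadratic, 1, alpha
   and b are linearly independent over Q, so the points (n alpha, n b) are dense
   modulo 1. Call n <= t the best approximation of c up to t if, among the
   numbers up to t whose alpha-phase is at most that of c, its alpha-phase is the
   largest. The t that are their own best approximation of C form a finite
   increasing sequence of times, and the best approximations of N_0, ..., N_3 up to
   these times have b-phases that can be prescribed up to a small error, by
   density and by choosing C and N_j in nested windows. These five numbers, a
   bound and a tolerance thus code an arbitrary finite sequence of quadruples of
   natural numbers, and decoding it needs a single universal quantifier over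
   linear inequalities.

   The sequence is read as a derivation: "there is a sequence (E) each of whose
   lines (A) follows from earlier lines (E), as checked against all smaller
   numbers (A)" has the form EAEA. Evaluation of a fixed recursive function has
   such derivations, whose rules are linear because an argument list is
   represented by the code 2^a (1 + 2 s) of its head a and tail s. So for every
   recursive g there is a matrix phi such that phi with its first variable set
   to n is true iff g(n) = 0. If a recursive function f decided truth, taking
   g(n) = f(code of the sentence "x_0 = n and phi" when phi has code n) and then
   n = code of phi would give a sentence that is true iff f says that it is
   false. *)
Require Import Defs.
From mathcomp Require Import all_boot all_order all_algebra.
From mathcomp Require Import boolp reals.
From mathcomp Require Import ring lra zify.
Set Implicit Arguments.
Unset Strict Implicit.
Unset Printing Implicit Defensive.
Import Order.TTheory GRing.Theory Num.Theory.
Local Open Scope ring_scope.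

(** * Simultaneous Kronecker approximation *)

(** Turns an integer multiplier into a natural one. In the application [c a] and [c b] are almost
    integers, so the shift hardly moves the point modulo 1. *)
Lemma nat_shift (M : int) (c : nat) : (0 < c)%N ->
  exists z : nat, z%:Z = M + (`|M|%N.+1)%:Z * c%:Z.
Proof.
move=> c0; case: M => m /=; first by exists (m + m.+1 * c)%N; lia.
by exists (m.+2 * c - m.+1)%N; nia.
Qed.

Section Kronecker.
Variables (R : archiRealFieldType) (a b : R).

Definition frac (x : R) : R := x - (Num.floor x)%:~R.

Lemma frac_ge0 x : 0 <= frac x.
Proof. by rewrite subr_ge0 floor_le. Qed.

Lemma frac_lt1 x : frac x < 1.
Proof. by rewrite ltrBlDl -(intrD _ _ 1%Z) floorD1_gt. Qed.

Lemma frac_eq (x : R) (p : int) : 0 <= x - p%:~R < 1 -> frac x = x - p%:~R.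
Proof.
move=> h; rewrite /frac (@floor_def _ x p) // intrD.
by move: h => /andP[? ?]; apply/andP; split; lra.
Qed.

Definition lin_indep3 : Prop := forall x y z : int,
  x%:~R + y%:~R * a + z%:~R * b = 0 -> [/\ x = 0, y = 0 & z = 0].

(** Pigeonhole: the unit square is cut into [(N+1)^2] boxes of side less than [e], and two of
    [(N+1)^2 + 1] multiples of [(a, b)] share a box. *)
Lemma dirichlet2 (e : R) : 0 < e ->
  exists n : nat, exists p q : int,
    [/\ (0 < n)%N, `|n%:R * a - p%:~R| < e & `|n%:R * b - q%:~R| < e].
Proof.
move=> e0; set N := Num.truncn e^-1.
have N1e : e^-1 < N.+1%:R by apply: truncnS_gt.
have N1gt0 : 0 < N.+1%:R :> R by rewrite ltr0n.
pose box (x : R) : 'I_N.+1 := inord (Num.truncn (frac x * N.+1%:R)).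
have box_close x y : box x = box y -> `|frac x - frac y| < e.
  have bnd z : (Num.truncn (frac z * N.+1%:R) < N.+1)%N.
    rewrite truncn_lt_nat ?mulr_ge0 ?frac_ge0 ?ltW//.
    by rewrite -[ltRHS]mul1r ltr_pM2r// frac_lt1.
  move=> /(congr1 val); rewrite /= !inordK //.
  have := truncn_itv (mulr_ge0 (frac_ge0 x) (ltW N1gt0)).
  have := truncn_itv (mulr_ge0 (frac_ge0 y) (ltW N1gt0)).
  move=> + + eq; rewrite eq; move: (Num.truncn _) => m; rewrite -natr1.
  move=> /andP[? ?] /andP[? ?].
  have : `|frac x - frac y| * N.+1%:R < 1.
    rewrite -[X in _ * X < _]gtr0_norm// -normrM ltr_norml mulrBl; lra.
  rewrite -ltr_pdivlMr// div1r => /lt_trans; apply.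
  by rewrite invf_plt.
pose F (i : 'I_(N.+1 * N.+1).+1) := (box (i%:R * a), box (i%:R * b)).
have [i [j [ij Fij]]] : exists i j : 'I_(N.+1 * N.+1).+1, (i < j)%N /\ F i = F j.
  have /injectivePn[i [j ij Fij]] : ~~ injectiveb F.
    apply/negP => /injectiveP/leq_card.
    by rewrite card_prod !card_ord ltnn.
  move: ij; rewrite -val_eqE /= neq_ltn => /orP[h|h]; first by exists i, j.
  by exists j, i.
case: Fij => /box_close ha /box_close hb.
exists (j - i)%N, (Num.floor (j%:R * a) - Num.floor (i%:R * a)),
  (Num.floor (j%:R * b) - Num.floor (i%:R * b)).
rewrite subn_gt0 ij natrB ?(ltnW ij)// !intrD !intrN; split=> //.
  by rewrite distrC in ha; congr (`|_| < _): ha; rewrite /frac; ring.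
by rewrite distrC in hb; congr (`|_| < _): hb; rewrite /frac; ring.
Qed.

Hypothesis ab_indep : lin_indep3.

(* Two short vectors of the group generated by (a,b) and Z^2 that are not
   parallel span a lattice of small mesh. If g = n(a,b) mod Z^2 and the shorter
   h = m(a,b) mod Z^2 were parallel, the vanishing determinant, an integral
   relation between 1, a and b, would give h = (m/n) g, so |h| >= |g|/n. *)
Lemma kronecker2 (x y e : R) : 0 < e ->
  exists n : nat, exists p q : int,
    `|n%:R * a - p%:~R - x| < e /\ `|n%:R * b - q%:~R - y| < e.
Proof.
move=> e0; have e4 : 0 < e / 4 by lra.
have [n [p [q [n0 hp hq]]]] := dirichlet2 e4.
set g1 := n%:R * a - p%:~R in hp; set g2 := n%:R * b - q%:~R in hq.
have n0R : 0 < n%:R :> R by rewrite ltr0n.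
have g1n0 : 0 < `|g1|.
  rewrite normr_gt0; apply/eqP => g0.
  have [|_ h _] := @ab_indep (- p) n%:Z 0.
    by rewrite intrN mul0r addr0 -g0 /g1 /=; ring.
  by move: n0; case: h => ->.
have d0 : 0 < Num.min (e / 4) (`|g1| / n%:R) by rewrite lt_min e4 divr_gt0.
have [m [r [s [m0 ]]]] := dirichlet2 d0; rewrite !lt_min => /andP[hr hr'] /andP[hs _].
set h1 := m%:R * a - r%:~R in hr hr'; set h2 := m%:R * b - s%:~R in hs.
have det : g1 * h2 - g2 * h1 != 0.
  apply/eqP => det0.
  have [|_ h k] := @ab_indep (p * s - q * r) (m%:Z * q - n%:Z * s) (n%:Z * r - m%:Z * p).
    by rewrite -det0 !(intrD, intrN, intrM) /g1 /g2 /h1 /h2 /=; ring.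
  have kR : n%:R * r%:~R = m%:R * p%:~R :> R.
    by move/(congr1 (intr : int -> R)): k; rewrite intrD intrN !intrM /=; lra.
  have : n%:R * h1 = m%:R * g1 by rewrite /h1 /g1 mulrBr kR; ring.
  move/(congr1 Num.norm); rewrite !normrM !normr_nat => E.
  move: hr'; rewrite ltr_pdivlMr// mulrC E.
  have : 1 <= m%:R :> R by rewrite ler1n.
  nra.
(* Coordinates of the target in the basis [g], [h], by Cramer's rule. Rounding them down costs less
   than [e / 2] in each component. *)
pose S := (x * h2 - y * h1) / (g1 * h2 - g2 * h1).
pose T := (g1 * y - g2 * x) / (g1 * h2 - g2 * h1).
have xE : x = S * g1 + T * h1 by rewrite /S /T; field.
have yE : y = S * g2 + T * h2 by rewrite /S /T; field.
pose k := Num.floor S; pose l := Num.floor T.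
have bnd (u v : R) : `|u| < e / 4 -> `|v| < e / 4 ->
    `|k%:~R * u + l%:~R * v - (S * u + T * v)| < e / 2.
  move=> hu hv.
  have -> : k%:~R * u + l%:~R * v - (S * u + T * v) = - (frac S * u + frac T * v).
    by rewrite /frac -/k -/l; ring.
  rewrite normrN (le_lt_trans (ler_normD _ _))// !normrM !(ger0_norm (frac_ge0 _)).
  have := frac_ge0 S; have := frac_ge0 T; have := frac_lt1 S; have := frac_lt1 T.
  have := normr_ge0 u; have := normr_ge0 v; nra.
pose M : int := k * n%:Z + l * m%:Z.
(* [M] may be negative, so [|M| + 1] times a multiplier [c] of error below [e'] is added; the choice
   of [e'] keeps the total extra error within [e / 2]. *)
have [e' e'0 [e'e e'M]] : exists2 e', 0 < e' & (e' <= e / 2 /\ e' * (`|M|%N%:R + 1) <= e / 2).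
  exists (e / 2 / (`|M|%N%:R + 1)).
    by rewrite divr_gt0// ?ltr_wpDl//; lra.
  have M1 : 0 < (`|M|%N%:R + 1) :> R by rewrite ltr_wpDl.
  rewrite divfK ?gt_eqF// ler_pdivrMr//; split=> //.
  by rewrite ler_peMr ?lerDr//; lra.
have [c [u [v [c0 hu hv]]]] := dirichlet2 e'0.
pose w : nat := (`|M|%N).+1.
have [z zE] := nat_shift M c0.
rewrite -/w in zE.
have zR : z%:R = k%:~R * n%:R + l%:~R * m%:R + w%:R * c%:R :> R.
  by move/(congr1 (intr : int -> R)): zE; rewrite /M !(intrD, intrM).
exists z, (k * p + l * r + w%:Z * u), (k * q + l * s + w%:Z * v).
have wE : w%:R = `|M|%N%:R + 1 :> R by rewrite /w -natr1.
have w0 : 0 <= w%:R :> R by [].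
have fin (g h t X A P : R) : X = S * g + T * h -> `|g| < e / 4 -> `|h| < e / 4 ->
    `|t| < e' -> A - P = k%:~R * g + l%:~R * h + w%:R * t -> `|A - P - X| < e.
  move=> -> hg hh ht ->; have := bnd _ _ hg hh.
  rewrite !ltr_norml => /andP[? ?].
  have : `|w%:R * t| < e / 2.
    rewrite normrM ger0_norm// wE (lt_le_trans _ e'M)// [ltRHS]mulrC ltr_pM2l//.
    by rewrite ltr_wpDl.
  by rewrite ltr_norml => /andP[? ?]; apply/andP; split; lra.
split; [apply: (fin g1 h1 _ _ _ _ xE hp hr hu)|apply: (fin g2 h2 _ _ _ _ yE hq hs hv)];
  by rewrite zR !(intrD, intrM) /g1 /h1 /g2 /h2 /=; ring.
Qed.

Lemma frac_dense2 (l h l' h' : R) :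
  0 <= l -> l < h -> h <= 1 -> 0 <= l' -> l' < h' -> h' <= 1 ->
  exists n : nat, l < frac (n%:R * a) < h /\ l' < frac (n%:R * b) < h'.
Proof.
move=> l0 lh h1 l'0 lh' h'1.
have e0 : 0 < Num.min ((h - l) / 2) ((h' - l') / 2) by rewrite lt_min; lra.
have [n [p [q []]]] := kronecker2 ((h + l) / 2) ((h' + l') / 2) e0.
rewrite !lt_min !ltr_norml => /andP[/andP[? ?] _] /andP[_ /andP[? ?]].
by exists n; rewrite (@frac_eq _ p) ?(@frac_eq _ q); lra.
Qed.

Lemma frac_inj_l (m n : nat) : frac (m%:R * a) = frac (n%:R * a) -> m = n.
Proof.
rewrite /frac => E.
have [|_ h _] := @ab_indep (Num.floor (n%:R * a) - Num.floor (m%:R * a)) (m%:Z - n%:Z) 0.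
  by rewrite !(intrD, intrN) mul0r /=; lra.
lia.
Qed.

Lemma frac_inj_r (m n : nat) : frac (m%:R * b) = frac (n%:R * b) -> m = n.
Proof.
rewrite /frac => E.
have [|_ _ h] := @ab_indep (Num.floor (n%:R * b) - Num.floor (m%:R * b)) 0 (m%:Z - n%:Z).
  by rewrite !(intrD, intrN) mul0r /=; lra.
lia.
Qed.
End Kronecker.

(** * Coding finite sequences by phases *)

Section Coding.
Variables (R : archiRealFieldType) (a b : R).
Hypothesis ab_indep : lin_indep3 a b.

Notation pa n := (frac (n%:R * a)).
Notation pb n := (frac (n%:R * b)).

Definition best (c n t : nat) : Prop :=
  [/\ (n <= t)%N, pa n <= pa c
    & forall m : nat, (m <= t)%N -> pa m <= pa c -> pa m <= pa n].

(** One decoded entry: [t] is its time and [q] its value, read off from the b-phases of the [n j].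
    The tolerance is the a-phase of a number [e], so that it too can be held by integer
    variables. *)
Definition supports (J C0 : nat) (N : nat -> nat) (B e t : nat) (n q : nat -> nat) :=
  best C0 t t /\ forall j, (j < J)%N ->
    [/\ best (N j) (n j) t, `|pb (n j) - pb (q j)| < pa e & (q j <= B)%N].

Lemma best_inj c n n' t : best c n t -> best c n' t -> n = n'.
Proof.
move=> [nt nc nm] [n't n'c n'm]; apply: (frac_inj_l ab_indep).
by apply/eqP; rewrite eq_le nm// n'm.
Qed.

(** Finitely many values cannot accumulate at [x]: the right end of the window is moved to the left
    past each of them in turn. *)
Lemma gap_right (f : nat -> R) (x h : R) (M : nat) : x < h ->
  exists h' : R, x < h' <= h /\ forall m, (m <= M)%N -> ~ (x < f m < h').
Proof.
move=> xh; elim: M => [|M [h' [/andP[xh' h'h] hM]]].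
  case: (ltP x (f 0%N)) => [xf|fx]; last first.
    exists h; rewrite xh lexx; split=> // m; rewrite leqn0 => /eqP-> /andP[].
    by rewrite ltNge fx.
  exists (Num.min h (f 0%N)); rewrite lt_min xh xf ge_min lexx; split=> // m.
  by rewrite leqn0 => /eqP->; rewrite lt_min ltxx !andbF.
case: (ltP x (f M.+1)) => [xf|fx]; last first.
  exists h'; rewrite xh' h'h; split=> // m; rewrite leq_eqVlt => /orP[/eqP->|/hM//].
  by rewrite ltNge fx.
exists (Num.min h' (f M.+1)); rewrite lt_min xh' xf ge_min h'h; split=> // m.
rewrite leq_eqVlt => /orP[/eqP->|/hM mh]; first by rewrite lt_min ltxx !andbF.
by rewrite lt_min => /andP[? /andP[? _]]; apply: mh; apply/andP.
Qed.

(* Among the times up to the new one, exactly the listed ones are records for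
   every C0 in the final window: each new time is the first number whose phase
   falls in the previous window. *)
Lemma coding_windows (J : nat) (w : nat -> nat -> nat) (eps : R) (K : nat) :
  0 < eps -> (forall j, w 0%N j = 0%N) ->
  exists (tm : nat -> nat) (nn : nat -> nat -> nat) (h0 : R) (h : nat -> R),
  [/\ pa (tm K) < h0 <= 1, forall j, pa (nn K j) < h j <= 1,
      forall i, (i < K)%N -> (tm i < tm i.+1)%N,
      forall i j, (i <= K)%N -> `|pb (nn i j) - pb (w i j)| < eps
    & forall C0 (N : nat -> nat), pa (tm K) <= pa C0 < h0 ->
      (forall j, pa (nn K j) <= pa (N j) < h j) ->
      (forall i, (i <= K)%N -> best C0 (tm i) (tm i) /\
         forall j, (j < J)%N -> best (N j) (nn i j) (tm i)) /\
      (forall t, (t <= tm K)%N -> best C0 t t -> exists2 i, (i <= K)%N & t = tm i)].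
Proof.
move=> eps0 w0.
have pa0 : pa 0%N = 0 by rewrite mul0r /frac floor0 subr0.
elim: K => [|K [tm [nn [h0 [h [hT hN tmS close H]]]]]].
  (* At time 0 the only candidate is 0, which fixes the first entry; the hypothesis on [w 0]
     accounts for this. *)
  exists (fun=> 0%N), (fun _ _ => 0%N), 1, (fun=> 1); split.
  - by rewrite pa0 ltr01 lexx.
  - by move=> _; rewrite pa0 ltr01 lexx.
  - by [].
  - by move=> i j; rewrite leqn0 => /eqP ->; rewrite w0 subrr normr0.
  have best0 c : best c 0 0.
    split=> // [|m]; first by rewrite pa0 frac_ge0.
    by rewrite leqn0 => /eqP->.
  move=> C0 N _ _; split=> [i _|t]; first by split=> // j _.
  by rewrite leqn0 => /eqP-> _; exists 0%N.
have /choice[n' n'P] : forall j, exists n : nat,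
    pa (nn K j) < pa n < h j /\ `|pb n - pb (w K.+1 j)| < eps.
  move=> j; have /andP[lh h1] := hN j; set v := w K.+1 j.
  have v1 : pb v < Num.min 1 (pb v + eps) by rewrite lt_min frac_lt1 ltrDl.
  have v2 : Num.min 1 (pb v + eps) <= 1 by rewrite ge_min lexx.
  have [n [n1 n2]] := frac_dense2 ab_indep (frac_ge0 _) lh h1 (frac_ge0 _) v1 v2.
  exists n; split=> //; move: n2; rewrite lt_min => /andP[? /andP[_ ?]].
  by rewrite ltr_norml; apply/andP; split; lra.
(* No number up to [M] has its phase strictly inside the window ending at [h0'], so the first number
   [t'] that does comes after the previous time and after all new approximations [n' j]. *)
pose M := maxn (tm K) (\max_(j < J) n' j).
have /andP[lT h01] := hT.
have [h0' [/andP[lh0' h0'h] gap]] := gap_right (fun n => pa n) M lT.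
have ext : exists t : nat, pa (tm K) < pa t < h0'.
  have [t [? _]] := frac_dense2 ab_indep (frac_ge0 _) lh0' (le_trans h0'h h01)
    (lexx 0) ltr01 (lexx 1).
  by exists t.
have [t' /andP[t'1 t'2] t'min] := ex_minnP ext.
have Mt' : (M < t')%N.
  by rewrite ltnNge; apply/negP => /gap; apply; rewrite t'1.
have tmt' : (tm K < t')%N by apply: leq_ltn_trans Mt'; rewrite leq_maxl.
have n't' j : (j < J)%N -> (n' j <= t')%N.
  move=> jJ; apply: leq_trans (ltnW Mt'); rewrite leq_max; apply/orP; right.
  exact: (@leq_bigmax _ (fun j : 'I_J => n' j) (Ordinal jJ)).
(* The windows are narrowed again until no number up to [t'] has its phase strictly inside them;
   this makes [t'] and the [n' j] best approximations at time [t']. *)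
have [h0'' [/andP[t'h h''h'] gap']] := gap_right (fun n => pa n) t' t'2.
have /choice[h' h'P] : forall j, exists h' : R, pa (n' j) < h' <= h j /\
    forall m, (m <= t')%N -> ~ (pa (n' j) < pa m < h').
  by move=> j; have [/andP[_ hj] _] := n'P j; apply: (gap_right (fun n => pa n)).
exists (fun i => if (i <= K)%N then tm i else t'),
  (fun i => if (i <= K)%N then nn i else n'), h0'', h'.
rewrite ltnn; split.
- by rewrite t'h (le_trans h''h')// (le_trans h0'h).
- move=> j; have [/andP[-> hh] _] := h'P j; rewrite (le_trans hh)//.
  by have /andP[] := hN j.
- move=> i; rewrite ltnS => iK; rewrite iK; case: (ltnP i K) => [|Ki]; first exact: tmS.
  by have -> : i = K by apply/eqP; rewrite eqn_leq iK Ki.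
- move=> i j iK1; case: leqP => [|Ki]; first exact: close.
  have -> : i = K.+1 by apply/eqP; rewrite eqn_leq iK1 Ki.
  by have [] := n'P j.
move=> C0 N /andP[C1 C2] hNN.
have C0K : pa (tm K) <= pa C0 < h0.
  by rewrite (le_trans (ltW t'1) C1) (lt_le_trans C2)// (le_trans h''h').
have [j|H1 H2] := H C0 N C0K.
  have [/andP[l1 l2] _] := n'P j; have [/andP[l3 l4] _] := h'P j.
  by have /andP[l5 l6] := hNN j; apply/andP; split; lra.
split=> [i iK1|t tt' tb].
  case: leqP => [|Ki]; first exact: H1.
  split=> [|j jJ]; split=> //.
  - move=> m mt' mC; rewrite leNgt; apply/negP => t'm; apply: (gap' m mt').
    by rewrite t'm (le_lt_trans mC).
  - exact: n't'.
  - by have /andP[] := hNN j.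
  move=> m mt' mC; rewrite leNgt; apply/negP => n'm.
  have [_ g] := h'P j; apply: (g m mt'); rewrite n'm (le_lt_trans mC)//.
  by have /andP[] := hNN j.
case: (leqP t (tm K)) => [tK|Kt].
  by have [i iK ->] := H2 t tK tb; exists i; rewrite ?iK// leqW.
(* A record [t] later than [tm K] has its phase strictly inside the window that defined [t'], so
   [t' <= t] by minimality. *)
exists K.+1; rewrite // ltnn; apply/eqP; rewrite eqn_leq tt' /=.
apply: t'min; case: tb => _ tC tb.
have Kt' : pa (tm K) <= pa t.
  by apply: tb; [exact: ltnW|case/andP: C0K].
rewrite (le_lt_trans tC (lt_le_trans C2 h''h')) andbT lt_neqAle Kt' andbT.
apply/eqP => /(frac_inj_l ab_indep) E; by rewrite E ltnn in Kt.
Qed.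

(** Distinct numbers have distinct b-phases, and only finitely many are compared. The bound is
    [eps + eps] because the coded value and a decoded candidate each lie within the tolerance of a
    common b-phase. *)
Lemma frac_separated (B : nat) : exists2 eps : R, 0 < eps & forall q q' : nat,
  (q <= B)%N -> (q' <= B)%N -> `|pb q - pb q'| < eps + eps -> q = q'.
Proof.
elim: B => [|B [eps eps0 sep]].
  by exists 1 => // q q'; rewrite !leqn0 => /eqP-> /eqP->.
suff [d d0 dP] : exists2 d : R, 0 < d & forall q : nat, (q <= B)%N ->
    d + d <= `|pb q - pb B.+1|.
  exists (Num.min eps d) => [|q q']; first by rewrite lt_min eps0.
  rewrite leq_eqVlt => /orP[/eqP->|qB]; rewrite leq_eqVlt => /orP[/eqP->//|q'B].
  - move=> h; have := dP _ q'B; rewrite distrC leNgt (lt_le_trans h)//.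
    by rewrite lerD// ge_min lexx orbT.
  - move=> h; have := dP _ qB; rewrite leNgt (lt_le_trans h)//.
    by rewrite lerD// ge_min lexx orbT.
  - by move=> h; apply: sep; rewrite ?(lt_le_trans h)// lerD// ge_min lexx.
have [h' [/andP[h'0 _] gap]] := gap_right (fun q => `|pb q - pb B.+1|) B ltr01.
exists (h' / 2) => [|q qB]; first by lra.
have -> : h' / 2 + h' / 2 = h' by lra.
rewrite leNgt; apply/negP => lt; apply: (gap q qB); rewrite lt andbT normr_gt0.
rewrite subr_eq0; apply/eqP => /(frac_inj_r ab_indep) E.
by rewrite E ltnn in qB.
Qed.

(** The left ends of the final windows, namely the last time and the last approximations, serve as
    [C0] and [N]. Decoding is unique by the separation of the b-phases up to [B]. *)
Lemma coding (J K : nat) (w : nat -> nat -> nat) : (forall j, w 0%N j = 0%N) ->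
  exists (C0 : nat) (N : nat -> nat) (B e : nat) (tm : nat -> nat),
  [/\ forall i, (i < K)%N -> (tm i < tm i.+1)%N,
      forall i, (i <= K)%N -> exists n, supports J C0 N B e (tm i) n (w i)
    & forall t n q, supports J C0 N B e t n q -> exists i,
        [/\ (i <= K)%N, t = tm i & forall j, (j < J)%N -> q j = w i j]].
Proof.
move=> w0; pose B : nat := \max_(i < K.+1) \max_(j < J) w i j.
have wB i j : (i <= K)%N -> (j < J)%N -> (w i j <= B)%N.
  move=> iK jJ.
  apply: leq_trans (@leq_bigmax _ (fun i : 'I_K.+1 => \max_(j < J) w i j) (inord i)).
  rewrite inordK//; exact: (@leq_bigmax _ (fun j : 'I_J => w i j) (Ordinal jJ)).
have [eps eps0 sep] := frac_separated B.
have eps1 : 0 < Num.min 1 eps by rewrite lt_min ltr01.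
have eps2 : Num.min 1 eps <= 1 by rewrite ge_min lexx.
have [e [/andP[e0 e1] _]] := frac_dense2 ab_indep (lexx 0) eps1 eps2
  (lexx 0) ltr01 (lexx 1).
have {e1} e1 : pa e <= eps by move: e1; rewrite lt_min => /andP[_ /ltW].
have [tm [nn [h0 [h [hT hN tmS close H]]]]] := @coding_windows J w (pa e) K e0 w0.
have [||H1 H2] := H (tm K) (nn K).
- by rewrite lexx; case/andP: hT.
- by move=> j; rewrite lexx; case/andP: (hN j).
exists (tm K), (nn K), B, e, tm; split=> //.
  move=> i iK; exists (nn i); have [b1 b2] := H1 i iK; split=> // j jJ.
  by split; [exact: b2|exact: close|exact: wB].
move=> t n q [tb tn].
(* As [C0] is [tm K] itself, a later record would have the same a-phase as [tm K], against
   injectivity. *)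
have tK : (t <= tm K)%N.
  rewrite leqNgt; apply/negP => Kt; have [_ t1 t2] := tb.
  have E : pa (tm K) = pa t by apply/eqP; rewrite eq_le t1 t2// ltnW.
  by move: (frac_inj_l ab_indep E) Kt => ->; rewrite ltnn.
have [i iK ti] := H2 t tK tb; exists i; split=> // j jJ.
have [nb nq qB] := tn j jJ; have [_ /(_ j jJ) b2] := H1 i iK.
rewrite ti in nb; rewrite (best_inj nb b2) in nq.
apply: sep => //; first exact: wB.
have := close i j iK; move: nq.
rewrite !ltr_norml => /andP[? ?] /andP[? ?]; apply/andP; split; lra.
Qed.
End Coding.

(** * Derivations with linear rules *)

Definition triple : Type := (nat * nat * nat)%type.

Definition fact : Type := (nat * triple)%type.

Definition fact_seq (q : fact) : seq nat := [:: q.1; q.2.1.1; q.2.1.2; q.2.2].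

(** Index [4 i + c] is entry [c] of the [i]-th fact, where fact 0 is the conclusion and entry 0 the
    label. *)
Definition fact_env (q a b c d : fact) : nat -> nat :=
  nth 0%N (fact_seq q ++ fact_seq a ++ fact_seq b ++ fact_seq c ++ fact_seq d).

Definition triple_seq (q : triple) : seq nat := [:: q.1.1; q.1.2; q.2].

(** The same without labels: index [3 i + c] is argument [c] of the [i]-th triple. The rules for
    single predicates are written in these indices. *)
Definition triple_env (q a b c d : triple) : nat -> nat :=
  nth 0%N (triple_seq q ++ triple_seq a ++ triple_seq b ++ triple_seq c
           ++ triple_seq d).

Inductive rule_def : ((nat -> nat) -> Prop) -> Prop :=
  | rule_eq i c j d : rule_def (fun e => e i = c * e j + d)%N
  | rule_and P Q : rule_def P -> rule_def Q -> rule_def (fun e => P e /\ Q e)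
  | rule_or P Q : rule_def P -> rule_def Q -> rule_def (fun e => P e \/ Q e)
  | rule_ext P Q : (forall e, P e <-> Q e) -> rule_def P -> rule_def Q.

Lemma rule_const i d : rule_def (fun e => e i = d).
Proof. by apply: rule_ext (rule_eq i 0 0 d) => e; rewrite mul0n add0n. Qed.

Lemma rule_var i j : rule_def (fun e => e i = e j).
Proof. by apply: rule_ext (rule_eq i 1 j 0) => e; rewrite mul1n addn0. Qed.

Lemma rule_succ i j : rule_def (fun e => e i = (e j).+1).
Proof. by apply: rule_ext (rule_eq i 1 j 1) => e; rewrite mul1n addn1. Qed.

Lemma rule_rename (r : nat -> nat) P : rule_def P -> rule_def (fun e => P (e \o r)).
Proof.
elim=> [i c j d|{}P Q _ IP _ IQ|{}P Q _ IP _ IQ|{}P Q PQ _ IP].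
- exact: rule_eq.
- exact: rule_and.
- exact: rule_or.
- by apply: rule_ext IP => e; apply: PQ.
Qed.

Create HintDb rules.
#[local] Hint Resolve rule_const rule_var rule_succ rule_eq rule_and rule_or : rules.

(* Facts labelled 0 hold by convention, so that a rule can have fewer than four
   premises. *)
Inductive derives (P : (nat -> nat) -> Prop) : fact -> Prop :=
  | derives0 t : derives P (0%N, t)
  | derives_rule q a b c d : P (fact_env q a b c d) ->
      derives P a -> derives P b -> derives P c -> derives P d -> derives P q.

Lemma derives_inv P l t : (0 < l)%N -> derives P (l, t) <->
  exists a b c d, P (fact_env (l, t) a b c d) /\
    [/\ derives P a, derives P b, derives P c & derives P d].
Proof.
move=> l0; split=> [|[a [b [c [d [Pe [? ? ? ?]]]]]]]; last exact: derives_rule Pe _ _ _ _.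
move E: (l, t) => q dq; case: dq E => [t' [l0']|q' a b c d Pe ? ? ? ? _].
  by rewrite l0' in l0.
by exists a, b, c, d.
Qed.

Definition pred3 : Type := triple -> Prop.

(* The labels from [s] to [s' - 1] belong to the rules for the predicates; any
   rule set that agrees with them on these labels derives the same facts. *)
Definition joint_rep (n : nat) (F : nat -> pred3) : Prop :=
  forall s, (0 < s)%N -> exists (l : nat -> nat) s' P,
    [/\ (s <= s')%N, rule_def P,
        forall e, P e -> (s <= e 0%N < s')%N
      & forall Q, (forall e, (s <= e 0%N < s')%N -> (Q e <-> P e)) ->
          forall i t, (i < n)%N -> derives Q (l i, t) <-> F i t].

Definition rep (F : pred3) : Prop := joint_rep 1 (fun=> F).

Lemma rule_false : rule_def (fun=> False).
Proof. by apply: rule_ext (rule_succ 0 0) => e; split=> //; lia. Qed.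

Lemma rep_True : rep (fun=> True).
Proof.
move=> s s0; exists (fun=> 0%N), s, (fun=> False); split=> //.
  exact: rule_false.
by move=> Q _ i t _; split=> // _; apply: derives0.
Qed.

(** The rule sets get consecutive ranges of labels, so their union agrees with each of them on its
    own range. *)
Lemma rep_joint n F : (forall i, (i < n)%N -> rep (F i)) -> joint_rep n F.
Proof.
elim: n => [|n IH] repF s s0.
  exists (fun=> 0%N), s, (fun=> False); split=> //; exact: rule_false.
have [l [s1 [P [ss1 defP rgP HP]]]] := IH (fun i h => repF i (ltnW h)) s s0.
have [l' [s2 [P' [ss2 defP' rgP' HP']]]] := repF n (ltnSn n) s1 (leq_trans s0 ss1).
exists (fun i => if (i < n)%N then l i else l' 0%N), s2, (fun e => P e \/ P' e).
split=> [|| e []|Q QE i t].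
- exact: leq_trans ss2.
- exact: rule_or.
- by move=> /rgP/andP[-> h]; rewrite (leq_trans h).
- by move=> /rgP'/andP[h ->]; rewrite (leq_trans ss1).
rewrite ltnS leq_eqVlt => /orP[/eqP->|iN].
  rewrite ltnn; apply: HP' => // e /andP[e1 e2].
  rewrite QE ?e2 ?(leq_trans ss1)//; split=> [[]|]//; last by right.
  by move=> /rgP; rewrite ltnNge e1 andbF.
rewrite iN; apply: HP => // e /andP[e1 e2].
rewrite QE ?e1 ?(leq_trans e2)//; split=> [[]|]//; last by left.
by move=> /rgP'; rewrite leqNgt e2.
Qed.

(** One base rule and one recursive rule, whose only recursive premise has a smaller first argument.
    Induction on that argument identifies derivability with [G]; the label [s] is used for [G] and
    the later ones for the [F i]. *)
Lemma rep_rec (G : pred3) (F : nat -> pred3) (Q1 Q2 : (nat -> nat) -> Prop) :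
  rule_def Q1 -> rule_def Q2 -> (forall i, (i < 7)%N -> rep (F i)) ->
  (forall t a b c d, Q2 (triple_env t a b c d) -> (a.1.1 < t.1.1)%N) ->
  (forall t, G t <->
    (exists a b c d, Q1 (triple_env t a b c d) /\
       [/\ F 0%N a, F 1%N b, F 2%N c & F 3%N d]) \/
    (exists a b c d, Q2 (triple_env t a b c d) /\
       [/\ G a, F 4%N b, F 5%N c & F 6%N d])) ->
  rep G.
Proof.
move=> dQ1 dQ2 /rep_joint repF dec GE s s0.
have [l [s' [P [ss' dP rgP HP]]]] := repF s.+1 (ltn0Sn s).
(* Translates positions among triples into positions among facts, skipping the labels. Positions
   from 15 on are out of range on both sides and give 0. *)
pose r i := (4 * (i %/ 3) + 1 + i %% 3)%N.
have envE q a b c d : fact_env q a b c d \o r = triple_env q.2 a.2 b.2 c.2 d.2.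
  apply/funext => i; have [i15|i15] := ltnP i 15.
    by do 15 (case: i i15 => [//|i] i15).
  rewrite /= /fact_env /triple_env !nth_default // /r.
  have : (5 <= i %/ 3)%N by rewrite leq_divRL.
  by rewrite /=; lia.
exists (fun=> s), s', (fun e => (e 0%N = s /\
   ((Q1 (e \o r) /\ (e 4%N = l 0%N /\ e 8%N = l 1%N /\ e 12%N = l 2%N /\ e 16%N = l 3%N)) \/
    (Q2 (e \o r) /\ (e 4%N = s /\ e 8%N = l 4%N /\ e 12%N = l 5%N /\ e 16%N = l 6%N)))) \/ P e).
split=> [||e []|Q QE i t _].
- exact: ltnW.
- by auto 10 using rule_rename with rules.
- by case=> -> _; rewrite leqnn ss'.
- by move=> /rgP/andP[h ->]; rewrite ltnW.
have HF u v : (u < 7)%N -> derives Q (l u, v) = F u v.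
  move=> u7; apply/propext; apply: HP u7 => e /andP[e1 e2]; rewrite QE ?e2 ?(ltnW e1)//.
  split=> [[[es]|]|]//; last by right.
  by rewrite es ltnn in e1.
have [k tk] := ubnP t.1.1; elim: k t tk => // k IH t tk.
rewrite derives_inv// GE.
have QE' a b c d : Q (fact_env (s, t) a b c d) <->
   ((Q1 (triple_env t a.2 b.2 c.2 d.2) /\
     (a.1 = l 0%N /\ b.1 = l 1%N /\ c.1 = l 2%N /\ d.1 = l 3%N)) \/
    (Q2 (triple_env t a.2 b.2 c.2 d.2) /\ (a.1 = s /\ b.1 = l 4%N /\ c.1 = l 5%N /\ d.1 = l 6%N))).
  rewrite QE /= ?leqnn ?ss'// envE; split; last by left; split.
  by case=> [[_]//|/rgP]; rewrite /= ltnn.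
split.
  case=> -[la a] [[lb b] [[lc c] [[ld d] [/QE'/= [|] [Qe [-> [-> [-> ->]]]]]]]].
    by rewrite !HF// => h; left; exists a, b, c, d.
  rewrite (propext (IH _ _)) ?HF//; last by apply: leq_trans (dec _ _ _ _ _ Qe) tk.
  by move=> h; right; exists a, b, c, d.
case=> -[a [b [c [d [Qe h]]]]].
  exists (l 0%N, a), (l 1%N, b), (l 2%N, c), (l 3%N, d).
  by rewrite QE' !HF//; split=> //; left; split.
exists (s, a), (l 4%N, b), (l 5%N, c), (l 6%N, d).
rewrite QE' !HF// (propext (IH _ _)); last by apply: leq_trans (dec _ _ _ _ _ Qe) tk.
by split=> //; right; split.
Qed.

(** * Recursive functions as derivations *)

Arguments triple_env q a b c d /.

Lemma rep_rec7 (G : pred3) (F0 F1 F2 F3 F4 F5 F6 : pred3) (Q1 Q2 : (nat -> nat) -> Prop) :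
  rule_def Q1 -> rule_def Q2 ->
  rep F0 -> rep F1 -> rep F2 -> rep F3 -> rep F4 -> rep F5 -> rep F6 ->
  (forall t a b c d, Q2 (triple_env t a b c d) -> (a.1.1 < t.1.1)%N) ->
  (forall t, G t <->
    (exists a b c d, Q1 (triple_env t a b c d) /\ [/\ F0 a, F1 b, F2 c & F3 d]) \/
    (exists a b c d, Q2 (triple_env t a b c d) /\ [/\ G a, F4 b, F5 c & F6 d])) ->
  rep G.
Proof.
move=> dQ1 dQ2 r0 r1 r2 r3 r4 r5 r6 dec GE.
apply: (rep_rec (F := nth F0 [:: F0; F1; F2; F3; F4; F5; F6]) dQ1 dQ2 _ dec GE).
move=> i; do 7 (case: i => [|i]; first by []); by rewrite !ltnS ltn0.
Qed.

Definition comp_pred (Q : (nat -> nat) -> Prop) (F0 F1 F2 F3 : pred3) : pred3 :=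
  fun t => exists a b c d, Q (triple_env t a b c d) /\
                           [/\ F0 a, F1 b, F2 c & F3 d].

Lemma rep_comp (F0 F1 F2 F3 : pred3) (Q : (nat -> nat) -> Prop) :
  rule_def Q -> rep F0 -> rep F1 -> rep F2 -> rep F3 ->
  rep (comp_pred Q F0 F1 F2 F3).
Proof.
move=> dQ r0 r1 r2 r3.
apply: (rep_rec7 dQ rule_false r0 r1 r2 r3 rep_True rep_True rep_True) => // t.
by split=> [|[//|[a [b [c [d []]]]]]]; first by left.
Qed.

(* [CodeSeq.code (x :: s) = code_cons x (CodeSeq.code s)] by conversion. *)
Definition code_cons (x y : nat) : nat := (2 ^ x * y.*2.+1)%N.

Lemma code_cons_inj x s a p :
  code_cons a p = CodeSeq.code (x :: s) -> a = x /\ p = CodeSeq.code s.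
Proof.
rewrite -[p]CodeSeq.decodeK -[code_cons _ _]/(CodeSeq.code (a :: CodeSeq.decode p)).
by move=> /(can_inj CodeSeq.codeK)[-> ->].
Qed.

Definition cons_pred : pred3 := fun t => t.2 = code_cons t.1.1 t.1.2.
Arguments cons_pred t /.

(** Recursion on the head: the code is [2 y + 1] for head 0 and doubles when the head grows by one,
    so multiplication by a constant suffices. *)
Lemma rep_cons : rep cons_pred.
Proof.
apply: (@rep_rec7 _ _ _ _ _ _ _ _
  (fun e => e 0%N = 0%N /\ e 2%N = 2 * e 1%N + 1)%N
  (fun e => e 0%N = (e 3%N).+1 /\ (e 4%N = e 1%N /\ e 2%N = 2 * e 5%N + 0)%N)
  _ _ rep_True rep_True rep_True rep_True rep_True rep_True rep_True).
- by auto with rules.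
- by auto with rules.
- by move=> t a b c d /= [-> _].
move=> [[x y] z]; rewrite /cons_pred /code_cons /=; split=> [->|[|]].
- case: x => [|x]; [left|right].
    do 4 exists (0, 0, 0)%N; rewrite /= expn0; split=> //; lia.
  exists (x, y, 2 ^ x * y.*2.+1)%N; do 3 exists (0, 0, 0)%N.
  by rewrite /= expnS; split=> //; lia.
- by move=> [a [b [c [d [[/= -> ->] _]]]]]; rewrite expn0; lia.
move=> [a [b [c [d [[/= -> [<- ->]] [-> _ _ _]]]]]]; rewrite expnS; lia.
Qed.

Fixpoint prim_rel (F G : pred3) (t p z : nat) : Prop :=
  if t is t'.+1 then
    exists z', prim_rel F G t' p z' /\ G (code_cons t' (code_cons z' p), z, 0)%N
  else F (p, z, 0)%N.

(** In the recursive rule, premise [a] is the preceding stage, [b] and [c] assemble the argument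
    code, and [d] applies [G]. *)
Lemma rep_prim F G : rep F -> rep G -> rep (fun t => prim_rel F G t.1.1 t.1.2 t.2).
Proof.
move=> rF rG; apply: (@rep_rec7 _ _ _ _ _ _ _ _
  (fun e => e 0%N = 0%N /\ (e 3%N = e 1%N /\ (e 4%N = e 2%N /\ e 5%N = 0%N)))
  (fun e => e 0%N = (e 3%N).+1 /\ (e 4%N = e 1%N /\ (e 6%N = e 5%N /\
     (e 7%N = e 1%N /\ (e 9%N = e 3%N /\ (e 10%N = e 8%N /\ (e 12%N = e 11%N /\
     (e 13%N = e 2%N /\ e 14%N = 0%N))))))))
  _ _ rF rep_True rep_True rep_True rep_cons rep_cons rG).
- by auto 6 with rules.
- by auto 12 with rules.
- by move=> t a b c d /= [-> _].
move=> [[x y] z] /=; split.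
  case: x => [|x] /= h; [left|right].
    by exists (y, z, 0)%N; do 3 exists (0, 0, 0)%N.
  have [z' [h1 h2]] := h.
  exists (x, y, z'), (z', y, code_cons z' y), (x, code_cons z' y, code_cons x (code_cons z' y)).
  by exists (code_cons x (code_cons z' y), z, 0)%N; do !split.
case=> -[[[a0 a1] a2] [[[b0 b1] b2] [[[c0 c1] c2] [[[d0 d1] d2] [/= H]]]]].
  by case: H => -> [-> [-> ->]] [].
case: H => -> [-> [-> [-> [-> [-> [-> [-> ->]]]]]]] [h /= -> -> k].
by exists a2.
Qed.

Definition below_pred (F : pred3) : pred3 := fun t =>
  forall u, (u < t.1.1)%N -> exists z, F (code_cons u t.1.2, z.+1, 0)%N.

(** The bounded universal quantifier is unfolded by recursion on the bound. The fourth premise is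
    trivially true and only holds the witness [z]. *)
Lemma rep_below F : rep F -> rep (below_pred F).
Proof.
move=> rF; apply: (@rep_rec7 _ _ _ _ _ _ _ _
  (fun e => e 0%N = 0%N)
  (fun e => e 0%N = (e 3%N).+1 /\ (e 4%N = e 1%N /\ (e 6%N = e 3%N /\
     (e 7%N = e 1%N /\ (e 9%N = e 8%N /\ (e 10%N = (e 12%N).+1 /\ e 11%N = 0%N))))))
  _ _ rep_True rep_True rep_True rep_True rep_cons rF rep_True).
- by auto 6 with rules.
- by auto 12 with rules.
- by move=> t a b c d /= [-> _].
move=> [[x y] z]; rewrite /below_pred /=; split.
  case: x => [|x] /= h; [left|right].
    by do 4 exists (0, 0, 0)%N.
  have [z' h'] := h x (ltnSn x).
  exists (x, y, 0)%N, (x, y, code_cons x y), (code_cons x y, z'.+1, 0)%N, (z', 0, 0)%N.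
  split; first by do !split.
  by split=> // u ux; apply: h; apply: ltnW.
case=> -[[[a0 a1] a2] [[[b0 b1] b2] [[[c0 c1] c2] [[[d0 d1] d2] [/= H]]]]].
  by rewrite H.
case: H => -> [-> [-> [-> [-> [-> ->]]]]] [h /= -> k _] u.
by rewrite ltnS leq_eqVlt => /orP[/eqP->|/h//]; exists d0.
Qed.

(** Arguments enter as one code and the last entry is padding, so that every arity fits into a
    triple. *)
Definition represents n (f : recfun n) (F : pred3) : Prop := rep F /\
  forall (v : n.-tuple nat) (y : nat), F (CodeSeq.code v, y, 0)%N <-> computes f v y.

Lemma represents_proj n (i : 'I_n) : exists F, represents (Proj i) F.
Proof.
suff [F [rF FE]] : exists F : pred3, rep F /\ forall (s : seq nat) y,
    (i < size s)%N -> F (CodeSeq.code s, y, 0)%N <-> y = nth 0%N s i.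
  by exists F; split=> // v y; rewrite FE ?size_tuple//= (tnth_nth 0%N).
elim: (val i) => {i} [|i [F [rF FE]]].
  exists (comp_pred (fun e => e 3%N = e 1%N /\ e 5%N = e 0%N)
    cons_pred (fun=> True) (fun=> True) (fun=> True)); split.
    apply: (rep_comp _ rep_cons rep_True rep_True rep_True); by auto with rules.
  move=> [//|x s] y _; split=> [[[[a0 a1] a2] [b [c [d [/= [<- ->] [/esym E _ _ _]]]]]]|->].
    by have [-> _] := code_cons_inj E.
  by exists (x, CodeSeq.code s, CodeSeq.code (x :: s)); do 3 exists (0, 0, 0)%N.
exists (comp_pred (fun e => e 5%N = e 0%N /\ (e 6%N = e 4%N /\ (e 7%N = e 1%N /\ e 8%N = 0%N)))
    cons_pred F (fun=> True) (fun=> True)); split.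
  by apply: (rep_comp _ rep_cons rF rep_True rep_True); auto 6 with rules.
move=> [//|x s] y; rewrite ltnS => /(FE _ y) <-; split.
  move=> [[[a0 a1] a2] [[[b0 b1] b2] [c [d [/= [-> [-> [-> ->]]] [/esym E Fb _ _]]]]]].
  by have [_ <-] := code_cons_inj E.
move=> Fs; exists (x, CodeSeq.code s, CodeSeq.code (x :: s)), (CodeSeq.code s, y, 0)%N.
by do 2 exists (0, 0, 0)%N.
Qed.

(** For composition: the values of all [g i] are gathered, one head at a time, into the single code
    on which the outer function acts. *)
Lemma represents_all m n (g : 'I_m -> recfun n) :
  (forall i, exists F, represents (g i) F) ->
  exists F : pred3, rep F /\ forall (v : n.-tuple nat) w, F (CodeSeq.code v, w, 0)%N <->
    exists2 u : m.-tuple nat, w = CodeSeq.code u & forall i, computes (g i) v (tnth u i).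
Proof.
elim: m g => [|m IH] g repg.
  exists (comp_pred (fun e => e 1%N = 0%N)
    (fun=> True) (fun=> True) (fun=> True) (fun=> True)).
  split; first by apply: rep_comp; auto using rep_True with rules.
  move=> v w; split=> [[a [b [c [d [/= -> _]]]]]|[u -> _]].
    by exists [tuple] => // -[].
  by rewrite tuple0; do 4 exists (0, 0, 0)%N.
have [F [rF FE]] := repg ord0.
have [H [rH HE]] := IH (fun i => g (lift ord0 i)) (fun i => repg _).
exists (comp_pred (fun e => e 3%N = e 0%N /\ (e 5%N = 0%N /\ (e 6%N = e 0%N /\ (e 8%N = 0%N /\
    (e 9%N = e 4%N /\ (e 10%N = e 7%N /\ e 11%N = e 1%N))))))
    F H cons_pred (fun=> True)).
split; first by apply: (rep_comp _ rF rH rep_cons rep_True); auto 10 with rules.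
move=> v w; split.
  move=> [[[a0 a1] a2] [[[b0 b1] b2] [[[c0 c1] c2] [d [/= E]]]]].
  case: E => -> [-> [-> [-> [-> [-> ->]]]]] [/FE Fa /HE[u -> gu] -> _].
  exists [tuple of a1 :: u] => // i.
  by case: (unliftP ord0 i) => [j ->|->]; rewrite ?tnthS// tnth0.
move=> [u -> gu]; case/tupleP: u gu => x u gu.
exists (CodeSeq.code v, x, 0)%N, (CodeSeq.code v, CodeSeq.code u, 0)%N.
exists (x, CodeSeq.code u, CodeSeq.code (x :: u)), (0, 0, 0)%N.
split; first by do !split.
split=> //; first by apply/FE; have := gu ord0; rewrite tnth0.
by apply/HE; exists u => // i; have := gu (lift ord0 i); rewrite tnthS.
Qed.

Lemma recfun_represents n (f : recfun n) : exists F, represents f F.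
Proof.
elim: f => {n} [||n i|m n f [F [rF FE]] g repg|n f [F [rF FE]] g [G [rG GE]]|n f [F [rF FE]]].
- exists (comp_pred (fun e => e 1%N = 0%N)
    (fun=> True) (fun=> True) (fun=> True) (fun=> True)).
  split; first by apply: rep_comp; auto using rep_True with rules.
  move=> v y; split=> [[a [b [c [d [/= -> _]]]]]//|/= ->].
  by do 4 exists (0, 0, 0)%N.
- exists (comp_pred (fun e => e 1%N = (e 3%N).+1 /\ (e 4%N = 0%N /\ e 5%N = e 0%N))
    cons_pred (fun=> True) (fun=> True) (fun=> True)).
  split; first by apply: (rep_comp _ rep_cons rep_True rep_True rep_True); auto with rules.
  move=> v y; case/tupleP: v => x v; rewrite (tuple0 v) /= theadE; split.
    move=> [[[a0 a1] a2] [b [c [d [/= [-> [-> ->]] [/esym E _ _ _]]]]]].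
    by have [->] := code_cons_inj (s := [::]) E.
  by move=> ->; exists (x, 0, CodeSeq.code [:: x])%N; do 3 exists (0, 0, 0)%N.
- exact: represents_proj.
- have [H [rH HE]] := represents_all repg.
  exists (comp_pred (fun e => e 3%N = e 0%N /\ (e 5%N = 0%N /\ (e 6%N = e 4%N /\
      (e 7%N = e 1%N /\ e 8%N = 0%N))))
    H F (fun=> True) (fun=> True)).
  split; first by apply: (rep_comp _ rH rF rep_True rep_True); auto 10 with rules.
  move=> v y; split.
    move=> [[[a0 a1] a2] [[[b0 b1] b2] [c [d [/= E]]]]].
    by case: E => -> [-> [-> [-> ->]]] [/HE[u -> gu] /FE Fb _ _]; exists u.
  move=> [u [gu fu]]; exists (CodeSeq.code v, CodeSeq.code u, 0)%N, (CodeSeq.code u, y, 0)%N.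
  do 2 exists (0, 0, 0)%N; split; first by do !split.
  by split=> //; [apply/HE; exists u|apply/FE].
- exists (comp_pred (fun e => e 5%N = e 0%N /\ (e 6%N = e 3%N /\ (e 7%N = e 4%N /\ e 8%N = e 1%N)))
    cons_pred (fun t => prim_rel F G t.1.1 t.1.2 t.2) (fun=> True) (fun=> True)).
  split.
    by apply: (rep_comp _ rep_cons (rep_prim rF rG) rep_True rep_True); auto 10 with rules.
  move=> v y; case/tupleP: v => t v.
  have primE (p : n.-tuple nat) u z : prim_rel F G u (CodeSeq.code p) z <->
      (fix iterate (t z : nat) : Prop := match t with
         | 0%N => computes f p z
         | t'.+1 => exists z', iterate t' z' /\
             computes g [tuple of t' :: z' :: p] z
         end) u z.
    elim: u z => [|u IH] z; first exact: FE.
    split=> [[z' [/IH h k]]|[z' [/IH h k]]]; exists z'; split=> //.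
      by apply/GE.
    by apply/(GE [tuple of u :: z' :: p]).
  have {}primE : computes (PrimRec f g) [tuple of t :: v] y <->
      prim_rel F G t (CodeSeq.code v) y.
    exact: iff_sym (primE [tuple of behead [tuple of t :: v]] t y).
  rewrite primE; split.
    move=> [[[a0 a1] a2] [[[b0 b1] b2] [c [d [/= E]]]]].
    case: E => -> [-> [-> ->]] [/esym E Fb _ _].
    by have [<- <-] := code_cons_inj E.
  move=> h; exists (t, CodeSeq.code v, CodeSeq.code (t :: v)), (t, CodeSeq.code v, y).
  by do 2 exists (0, 0, 0)%N; do !split.
(* Minimization: one premise gives the value 0 at [y], and [below_pred F] gives definedness with
   positive values before [y]. *)
exists (comp_pred (fun e => e 3%N = e 1%N /\ (e 4%N = e 0%N /\ (e 6%N = e 5%N /\ (e 7%N = 0%N /\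
    (e 8%N = 0%N /\
    (e 9%N = e 1%N /\ e 10%N = e 0%N))))))
    cons_pred F (below_pred F) (fun=> True)).
split.
  by apply: (rep_comp _ rep_cons rF (rep_below rF) rep_True); auto 10 with rules.
move=> v y; split.
  move=> [[[a0 a1] a2] [[[b0 b1] b2] [[[c0 c1] c2] [d [/= E]]]]].
  case: E => -> [-> [-> [-> [-> [-> ->]]]]] [/= -> /(FE [tuple of y :: v]) Fb h _].
  by split=> // t /h[z /(FE [tuple of t :: v])]; exists z.
move=> [f0 fS]; exists (y, CodeSeq.code v, code_cons y (CodeSeq.code v)).
exists (code_cons y (CodeSeq.code v), 0, 0)%N, (y, CodeSeq.code v, 0)%N, (0, 0, 0)%N.
split; first by do !split.
split=> //; first by apply/(FE [tuple of y :: v]).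
by move=> u /fS[z h]; exists z; apply/(FE [tuple of u :: v]).
Qed.

(** An extra rule forms the code of the one-entry argument list, so that the goal fact contains the
    input [n] itself. Labels start at 1, since label 0 holds by convention. *)
Lemma computes_rule (g : recfun 1) : exists P l, rule_def P /\
  forall n : nat, derives P (l, (n, 0, 0))%N <-> computes g [tuple n] 0.
Proof.
have [F [rF FE]] := recfun_represents g.
have rG : rep (comp_pred (fun e => e 3%N = e 0%N /\ (e 4%N = 0%N /\ (e 6%N = e 5%N /\
      (e 7%N = 0%N /\ e 8%N = 0%N))))
    cons_pred F (fun=> True) (fun=> True)).
  by apply: (rep_comp _ rep_cons rF rep_True rep_True); auto 10 with rules.
have [l [s' [P [_ dP _ HP]]]] := rG 1%N isT.
exists P, (l 0%N); split=> // n; rewrite (HP P) // -(FE [tuple n]); split.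
  move=> [[[a0 a1] a2] [[[b0 b1] b2] [c [d [/= E]]]]].
  by case: E => -> [-> [-> [-> ->]]] [-> ].
move=> h; exists (n, 0, CodeSeq.code [:: n])%N, (CodeSeq.code [:: n], 0, 0)%N.
by do 2 exists (0, 0, 0)%N; do !split.
Qed.

(** * Formulas over natural-number slots *)

Section Formulas.
Variables (R : realType) (al : R) (d : nat).
Hypothesis d3 : (2 < d)%N.

Definition zalpha_mon (e : nat) (z : int) : zalpha d :=
  [tuple if (i == e :> nat) then z else 0 | i < d].

Definition zalpha_add (c c' : zalpha d) : zalpha d :=
  [tuple tnth c i + tnth c' i | i < d].

Definition zalpha_opp (c : zalpha d) : zalpha d := [tuple - tnth c i | i < d].

Lemma zalpha_mon_val e z : (e < 3)%N ->
  zalpha_val al (zalpha_mon e z) = z%:~R * al ^+ e.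
Proof.
move=> e3; have ed : (e < d)%N by apply: leq_trans e3 d3.
rewrite /zalpha_val (bigD1 (Ordinal ed)) //= tnth_mktuple eqxx big1 ?addr0// => i.
by rewrite -val_eqE /= tnth_mktuple => /negPf->; rewrite mul0r.
Qed.

Lemma zalpha_add_val c c' :
  zalpha_val al (zalpha_add c c') = zalpha_val al c + zalpha_val al c'.
Proof.
rewrite /zalpha_val -big_split; apply: eq_bigr => i _ /=.
by rewrite tnth_mktuple intrD mulrDl.
Qed.

Lemma zalpha_opp_val c : zalpha_val al (zalpha_opp c) = - zalpha_val al c.
Proof.
rewrite /zalpha_val -sumrN; apply: eq_bigr => i _ /=.
by rewrite tnth_mktuple intrN mulNr.
Qed.

(** Access by natural-number position, with value 0 out of range, so that offsets can be computed
    freely. *)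
Definition coord n (x : 'rV[int]_n) (p : nat) : int := oapp (x 0) 0 (insub p).

Lemma coord_row_mx n m (x : 'rV[int]_n) (y : 'rV[int]_m) p :
  coord (row_mx x y) p = if (p < n)%N then coord x p else coord y (p - n).
Proof.
rewrite /coord; case: ltnP => pn.
  have pnm : (p < n + m)%N by rewrite ltn_addr.
  rewrite !insubT /= -(row_mxEl x y); congr (row_mx x y _ _); exact: val_inj.
case: (ltnP (p - n) m) => pm.
  have pnm : (p < n + m)%N by rewrite -(subnKC pn) ltn_add2l.
  rewrite !insubT /= -(row_mxEr x y); congr (row_mx x y _ _).
  by apply: val_inj; rewrite /= subnKC.
rewrite !insubN -?leqNgt //; lia.
Qed.

Definition lin_def n (F : 'rV[int]_n -> R) : Prop :=
  exists l : linform d n, forall x, linform_val al l x = F x.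

Lemma lin_ext n (F G : 'rV[int]_n -> R) : F =1 G -> lin_def F -> lin_def G.
Proof. by move=> FG [l lF]; exists l => x; rewrite lF. Qed.

Definition lin_form n (p : nat) (e : nat) (z : int) (c : int) : linform d n :=
  ([tuple zalpha_mon e (if i == p :> nat then z else 0) | i < n], zalpha_mon 0 c).

Lemma lin_form_val n (x : 'rV[int]_n) p e z c : (e < 3)%N ->
  linform_val al (lin_form n p e z c) x =
  z%:~R * al ^+ e * (coord x p)%:~R + c%:~R.
Proof.
move=> e3; rewrite /linform_val /= (zalpha_mon_val c (isT : (0 < 3)%N)) mulr1.
congr (_ + _); rewrite /coord; case: (ltnP p n) => pn.
  rewrite insubT /= (bigD1 (Ordinal pn)) //= tnth_mktuple eqxx zalpha_mon_val//.
  rewrite big1 ?addr0// => i; rewrite -val_eqE /= tnth_mktuple => /negPf->.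
  by rewrite zalpha_mon_val// !mul0r.
rewrite insubN -?leqNgt//= mulr0 big1// => i _; rewrite tnth_mktuple.
have /negPf-> : val i != p by rewrite neq_ltn (leq_trans (ltn_ord i) pn).
by rewrite zalpha_mon_val// !mul0r.
Qed.

Lemma lin_coord n p e : (e < 3)%N ->
  lin_def (fun x : 'rV[int]_n => al ^+ e * (coord x p)%:~R).
Proof.
by move=> e3; exists (lin_form n p e 1 0) => x; rewrite lin_form_val// mul1r addr0.
Qed.

Lemma lin_const n (c : int) : lin_def (fun _ : 'rV[int]_n => c%:~R).
Proof.
by exists (lin_form n 0 0 0 c) => x; rewrite lin_form_val// !mul0r add0r.
Qed.

Lemma lin_add n (F G : 'rV[int]_n -> R) :
  lin_def F -> lin_def G -> lin_def (fun x => F x + G x).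
Proof.
move=> [l lF] [l' lG].
exists ([tuple zalpha_add (tnth l.1 i) (tnth l'.1 i) | i < n], zalpha_add l.2 l'.2) => x.
rewrite -lF -lG /linform_val /= zalpha_add_val addrACA; congr (_ + _).
rewrite -big_split; apply: eq_bigr => i _ /=.
by rewrite tnth_mktuple zalpha_add_val mulrDl.
Qed.

Lemma lin_opp n (F : 'rV[int]_n -> R) : lin_def F -> lin_def (fun x => - F x).
Proof.
move=> [l lF]; exists ([tuple zalpha_opp (tnth l.1 i) | i < n], zalpha_opp l.2) => x.
rewrite -lF /linform_val /= zalpha_opp_val opprD; congr (_ + _).
rewrite -sumrN; apply: eq_bigr => i _ /=.
by rewrite tnth_mktuple zalpha_opp_val mulNr.
Qed.

Lemma lin_sub n (F G : 'rV[int]_n -> R) :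
  lin_def F -> lin_def G -> lin_def (fun x => F x - G x).
Proof. by move=> lF lG; apply: lin_add (lin_opp lG). Qed.

Definition qf_def n (P : 'rV[int]_n -> Prop) : Prop :=
  exists phi : formula d n, forall x, formula_holds al phi x <-> P x.

Lemma qf_ext n (P Q : 'rV[int]_n -> Prop) :
  (forall x, P x <-> Q x) -> qf_def P -> qf_def Q.
Proof. by move=> PQ [phi E]; exists phi => x; rewrite E. Qed.

Lemma qf_ge0 n (F : 'rV[int]_n -> R) : lin_def F -> qf_def (fun x => 0 <= F x).
Proof. by move=> [l E]; exists (Ge0 l) => x /=; rewrite E. Qed.

Lemma qf_gt0 n (F : 'rV[int]_n -> R) : lin_def F -> qf_def (fun x => 0 < F x).
Proof. by move=> [l E]; exists (Gt0 l) => x /=; rewrite E. Qed.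

Lemma qf_not n (P : 'rV[int]_n -> Prop) : qf_def P -> qf_def (fun x => ~ P x).
Proof. by move=> [p E]; exists (Not p) => x /=; rewrite E. Qed.

Lemma qf_and n (P Q : 'rV[int]_n -> Prop) :
  qf_def P -> qf_def Q -> qf_def (fun x => P x /\ Q x).
Proof. by move=> [p E] [q E']; exists (And p q) => x /=; rewrite E E'. Qed.

Lemma qf_or n (P Q : 'rV[int]_n -> Prop) :
  qf_def P -> qf_def Q -> qf_def (fun x => P x \/ Q x).
Proof. by move=> [p E] [q E']; exists (Or p q) => x /=; rewrite E E'. Qed.

Lemma qf_imp n (P Q : 'rV[int]_n -> Prop) :
  qf_def P -> qf_def Q -> qf_def (fun x => P x -> Q x).
Proof.
move=> qP qQ; apply: qf_ext (qf_or (qf_not qP) qQ) => x.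
by split=> [[]//|h]; case: (pselect (P x)) => [/h|]; [right|left].
Qed.

Lemma qf_all n m (P : nat -> 'rV[int]_n -> Prop) :
  (forall i, (i < m)%N -> qf_def (P i)) ->
  qf_def (fun x => forall i, (i < m)%N -> P i x).
Proof.
elim: m => [|m IH] qP.
  by exists (Ge0 (lin_form n 0 0 0 0)) => x /=; split=> // _; rewrite lin_form_val// !mul0r addr0.
apply: qf_ext (qf_and (IH (fun i im => qP i (ltnW im))) (qP m (ltnSn m))) => x.
split=> [[h hm] i|h]; last by split=> [i im|]; apply: h => //; apply: ltnW.
by rewrite ltnS leq_eqVlt => /orP[/eqP->|/h].
Qed.

(* A natural number is stored as three integer variables, so that its phases
   modulo 1 become linear expressions. *)
Definition slot_val (n c : nat) : int :=
  if c is c'.+1 then Num.floor (n%:R * al ^+ c'.+1) else n%:Z.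

Definition stores B n (x : 'rV[int]_n) (off : nat) (u : nat -> nat) : Prop :=
  forall i c, (i < B)%N -> (c < 3)%N ->
    coord x (off + (3 * i + c)) = slot_val (u i) c.

(** The quantifier-free form of storing some numbers: [q] is the floor of [y] iff
    [0 <= y - q < 1]. *)
Definition valid B n (x : 'rV[int]_n) (off : nat) : Prop :=
  forall i, (i < B)%N ->
    (0 <= (coord x (off + 3 * i))%:~R :> R) /\
    forall c, (c < 2)%N ->
      (0 <= al ^+ c.+1 * (coord x (off + 3 * i))%:~R - (coord x (off + (3 * i + c.+1)))%:~R) /\
      (0 < (coord x (off + (3 * i + c.+1)))%:~R + 1 - al ^+ c.+1 * (coord x (off + 3 * i))%:~R).

Lemma validP B n (x : 'rV[int]_n) off :
  valid B x off <-> exists u, stores B x off u.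
Proof.
split=> [vx|[u ux] i iB].
  exists (fun i => absz (coord x (off + 3 * i))) => i c iB c3.
  have [x0 h] := vx i iB; rewrite ler0z in x0.
  case: c c3 => [|c] c3; first by rewrite addn0 /= gez0_abs.
  have [h1 h2] := h c c3; rewrite /= pmulrn gez0_abs//; apply/esym/floor_def.
  by rewrite intrD mulrC; apply/andP; split; lra.
have x0 : coord x (off + 3 * i) = (u i)%:Z by have := ux i 0%N iB isT; rewrite addn0.
rewrite x0 ler0z; split=> // c c2.
rewrite (ux i c.+1)//= mulrC -pmulrn.
have /andP := floor_itv ((u i)%:R * al ^+ c.+1); rewrite intrD => -[? ?].
by split; lra.
Qed.

Lemma qf_valid B n off : qf_def (fun x : 'rV[int]_n => valid B x off).
Proof.
apply: qf_all => i _; apply: qf_and.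
  apply: qf_ge0; apply: lin_ext (@lin_coord n (off + 3 * i) 0 isT) => x.
  by rewrite mul1r.
have lin1 p : lin_def (fun x : 'rV[int]_n => (coord x p)%:~R).
  by apply: lin_ext (@lin_coord n p 0 isT) => x; rewrite mul1r.
apply: qf_all => c c2; apply: qf_and; [apply: qf_ge0|apply: qf_gt0].
  by apply: lin_sub => //; apply: lin_coord.
apply: lin_sub; last exact: lin_coord.
by apply: lin_add => //; apply: (lin_const n 1).
Qed.

Variables (B k : nat).
Hypothesis Bk : (3 * B <= k)%N.

Lemma stores_exists (u : nat -> nat) : exists x : 'rV[int]_k, stores B x 0 u.
Proof.
exists (\row_(j < k) slot_val (u (j %/ 3)%N) (j %% 3)%N) => i c iB c3.
have ik : (3 * i + c < k)%N by apply: leq_trans Bk; lia.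
rewrite /coord add0n insubT /= mxE /=; congr (slot_val (u _) _); lia.
Qed.

Definition assign (u0 u1 u2 u3 : nat -> nat) (b : nat) : nat -> nat :=
  match b with 0 => u0 | 1 => u1 | 2 => u2 | _ => u3 end%N.

Definition blocks (x0 x1 x2 x3 : 'rV[int]_k) : 'rV[int]_(sumn (nseq 4 k)) :=
  row_mx x0 (row_mx x1 (row_mx x2 (row_mx x3 0))).

Lemma blocks_stores x0 x1 x2 x3 u b : (b < 4)%N ->
  stores B (blocks x0 x1 x2 x3) (b * k) u <->
  stores B (nth x3 [:: x0; x1; x2] b) 0 u.
Proof.
move=> b4; suff E i c : (i < B)%N -> (c < 3)%N ->
    coord (blocks x0 x1 x2 x3) (b * k + (3 * i + c)) =
    coord (nth x3 [:: x0; x1; x2] b) (0 + (3 * i + c)).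
  by split=> h i c iB c3; rewrite -(h i c iB c3) E.
move=> iB c3; have ik : (3 * i + c < k)%N by apply: leq_trans Bk; lia.
rewrite add0n /blocks; move: (3 * i + c)%N ik => p pk.
have F j : (j.+1 * k + p < k)%N = false /\ (j.+1 * k + p - k = j * k + p)%N by lia.
case: b b4 => [|[|[|[|//]]]] _ /=; rewrite ?mul0n ?add0n;
  by rewrite !(coord_row_mx, (F _).1, (F _).2, mul0n, add0n, pk).
Qed.

(** Terms in the stored numbers, independent of their layout as integer variables. Phases count as
    linear, being a multiple of the number minus its stored floor. *)
Inductive slot_lin : ((nat -> nat -> nat) -> R) -> Prop :=
  | slot_nat b i : (b < 4)%N -> (i < B)%N -> slot_lin (fun u => (u b i)%:R)
  | slot_frac1 b i : (b < 4)%N -> (i < B)%N -> slot_lin (fun u => frac ((u b i)%:R * al))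
  | slot_frac2 b i : (b < 4)%N -> (i < B)%N -> slot_lin (fun u => frac ((u b i)%:R * al ^+ 2))
  | slot_const (z : int) : slot_lin (fun=> z%:~R)
  | slot_add F G : slot_lin F -> slot_lin G -> slot_lin (fun u => F u + G u)
  | slot_opp F : slot_lin F -> slot_lin (fun u => - F u).

Inductive slot_def : ((nat -> nat -> nat) -> Prop) -> Prop :=
  | slot_ge0 F : slot_lin F -> slot_def (fun u => 0 <= F u)
  | slot_not P : slot_def P -> slot_def (fun u => ~ P u)
  | slot_and P Q : slot_def P -> slot_def Q -> slot_def (fun u => P u /\ Q u)
  | slot_or P Q : slot_def P -> slot_def Q -> slot_def (fun u => P u \/ Q u).

Lemma slot_lin_sound F : slot_lin F -> exists2 G, lin_def G &
  forall (x : 'rV[int]_(sumn (nseq 4 k))) u,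
    (forall b, (b < 4)%N -> stores B x (b * k) (u b)) -> G x = F u.
Proof.
pose g b i c := fun x : 'rV[int]_(sumn (nseq 4 k)) => coord x (b * k + (3 * i + c)).
have lg b i : lin_def (fun x => (g b i 0%N x)%:~R).
  by apply: lin_ext (@lin_coord _ (b * k + (3 * i + 0)) 0 isT) => x; rewrite mul1r.
elim=> {F} [b i b4 iB|b i b4 iB|b i b4 iB|z|F F' _ [G lG E] _ [G' lG' E']|F _ [G lG E]].
- by exists (fun x => (g b i 0%N x)%:~R) => // x u /(_ b b4) st; rewrite /g st.
- exists (fun x => al ^+ 1 * (g b i 0%N x)%:~R - (g b i 1%N x)%:~R).
    apply: lin_sub; first exact: lin_coord.
    apply: lin_ext (@lin_coord _ (b * k + (3 * i + 1)) 0 isT) => x; exact: mul1r.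
  by move=> x u /(_ b b4) st; rewrite /g !st//= expr1 /frac mulrC.
- exists (fun x => al ^+ 2 * (g b i 0%N x)%:~R - (g b i 2%N x)%:~R).
    apply: lin_sub; first exact: lin_coord.
    apply: lin_ext (@lin_coord _ (b * k + (3 * i + 2)) 0 isT) => x; exact: mul1r.
  by move=> x u /(_ b b4) st; rewrite /g !st//= /frac mulrC.
- by exists (fun=> z%:~R) => //; apply: lin_const.
- exists (fun x => G x + G' x); first exact: lin_add.
  by move=> x u st; rewrite (E _ u)// (E' _ u).
- exists (fun x => - G x); first exact: lin_opp.
  by move=> x u st; rewrite (E _ u).
Qed.

Lemma slot_def_sound P : slot_def P -> exists2 Q, qf_def Q &
  forall (x : 'rV[int]_(sumn (nseq 4 k))) u,
    (forall b, (b < 4)%N -> stores B x (b * k) (u b)) -> Q x <-> P u.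
Proof.
elim=> {P} [F /slot_lin_sound[G lG E]|P _ [Q qQ E]|P P' _ [Q qQ E] _ [Q' qQ' E']|
  P P' _ [Q qQ E] _ [Q' qQ' E']].
- exists (fun x => 0 <= G x); first exact: qf_ge0.
  by move=> x u /E->.
- exists (fun x => ~ Q x); first exact: qf_not.
  by move=> x u /E->.
- exists (fun x => Q x /\ Q' x); first exact: qf_and.
  by move=> x u st; rewrite (E _ _ st) (E' _ _ st).
- exists (fun x => Q x \/ Q' x); first exact: qf_or.
  by move=> x u st; rewrite (E _ _ st) (E' _ _ st).
Qed.

(** Says that [m - x_0] is nonnegative and not positive. It is a concrete formula because its code
    has to be computed from [m]. *)
Definition input_formula n (m : nat) : formula d n :=
  And (Ge0 (lin_form n 0 0 (-1) m)) (Not (Gt0 (lin_form n 0 0 (-1) m))).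

Lemma input_formulaP n m (x : 'rV[int]_n) :
  formula_holds al (input_formula n m) x <-> coord x 0 = m.
Proof.
rewrite /= lin_form_val// expr0 mulr1 intrN mulN1r addrC subr_ge0 subr_gt0.
rewrite ler_int ltr_int; split=> [[]|->].
  by move=> ? /negP; rewrite -leNgt => ?; lia.
by rewrite ltxx.
Qed.

(** Quantifiers over integer vectors are relativized to valid ones: validity is a conjunct for the
    existential blocks and a premise for the universal blocks. *)
Lemma EAEA_slots (P : (nat -> nat -> nat) -> Prop) : (0 < B)%N -> slot_def P ->
  exists phi : EAEA_sentence d k, forall n : nat,
    EAEA_true al (And (input_formula _ n) phi : EAEA_sentence d k) <->
    exists u0, u0 0%N = n /\ forall u1, exists u2, forall u3, P (assign u0 u1 u2 u3).
Proof.
move=> B0 /slot_def_sound[Q qQ QP].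
have [phi phiE] : qf_def (fun x : 'rV[int]_(sumn (nseq 4 k)) =>
    valid B x (0 * k) /\ (valid B x (1 * k) -> valid B x (2 * k) /\
      (valid B x (3 * k) -> Q x))).
  by do ![exact: qf_valid|apply: qf_and|apply: qf_imp|].
exists phi => n.
have true_blocks : EAEA_true al (And (input_formula _ n) phi : EAEA_sentence d k) <->
    exists x0, forall x1, exists x2, forall x3,
      formula_holds al (And (input_formula _ n) phi) (blocks x0 x1 x2 x3) by [].
have st x0 x1 x2 x3 u0 u1 u2 u3 :
    stores B x0 0 u0 -> stores B x1 0 u1 -> stores B x2 0 u2 -> stores B x3 0 u3 ->
    Q (blocks x0 x1 x2 x3) <-> P (assign u0 u1 u2 u3).
  move=> h0 h1 h2 h3; apply: QP => b b4; apply/blocks_stores => //.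
  by case: b b4 => [|[|[|[|//]]]].
have vl x0 x1 x2 x3 b : (b < 4)%N -> valid B (blocks x0 x1 x2 x3) (b * k) <->
    exists u, stores B (nth x3 [:: x0; x1; x2] b) 0 u.
  move=> b4; rewrite validP; split=> -[u h]; exists u; exact/blocks_stores.
have in0 x0 x1 x2 x3 u0 : stores B x0 0 u0 -> coord (blocks x0 x1 x2 x3) 0 = (u0 0%N)%:Z.
  move=> /(_ 0%N 0%N B0 isT) h; rewrite /blocks coord_row_mx ifT; first exact: h.
  by apply: leq_trans Bk; rewrite muln_gt0.
rewrite true_blocks; split.
  move=> [x0 h].
  have [u0 s0] : exists u, stores B x0 0 u.
    have [x2 /(_ 0) [_ /phiE[+ _]]] := h 0.
    by rewrite (vl _ _ _ _ 0%N).
  exists u0; split.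
    have [x2 /(_ 0) [/input_formulaP + _]] := h 0.
    by rewrite (in0 _ _ _ _ _ s0) => -[].
  move=> u1; have [x1 s1] := stores_exists u1; have [x2 h2] := h x1.
  have hh x3 := (phiE _).1 (h2 x3).2.
  have v1 x3 : valid B (blocks x0 x1 x2 x3) (1 * k) by apply/(vl _ _ _ _ 1%N) => //; exists u1.
  have [u2 s2] : exists u, stores B x2 0 u.
    by have [_ /(_ (v1 0))[+ _]] := hh 0; rewrite (vl _ _ _ _ 2%N).
  exists u2 => u3; have [x3 s3] := stores_exists u3.
  have [_ /(_ (v1 x3))[_ hQ]] := hh x3.
  by apply/(st _ _ _ _ _ _ _ _ s0 s1 s2 s3); apply: hQ; apply/(vl _ _ _ _ 3%N) => //; exists u3.
move=> [u0 [u00 h]]; have [x0 s0] := stores_exists u0; exists x0 => x1.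
have [[u1 s1]|n1] := pselect (exists u, stores B x1 0 u); last first.
  exists 0 => x3; split; first by apply/input_formulaP; rewrite (in0 _ _ _ _ _ s0) u00.
  apply/phiE; split; first by apply/(vl _ _ _ _ 0%N) => //; exists u0.
  by move=> /(vl _ _ _ _ 1%N isT)/n1.
have [u2 h2] := h u1; have [x2 s2] := stores_exists u2; exists x2 => x3.
split; first by apply/input_formulaP; rewrite (in0 _ _ _ _ _ s0) u00.
apply/phiE; split; first by apply/(vl _ _ _ _ 0%N) => //; exists u0.
move=> _; split; first by apply/(vl _ _ _ _ 2%N) => //; exists u2.
by move=> /(vl _ _ _ _ 3%N isT)[u3 s3]; apply/(st _ _ _ _ _ _ _ _ s0 s1 s2 s3).
Qed.
End Formulas.

(** * The sentence of a derivation system *)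

Section Sentence.
Variables (R : realType) (al : R).
Notation pa n := (frac (n%:R * al)).
Notation pb n := (frac (n%:R * al ^+ 2)).
Notation B := 46%N.
Notation slin := (slot_lin al B).
Notation sdef := (slot_def al B).

Lemma slot_lin_ext (F G : (nat -> nat -> nat) -> R) : F =1 G -> slin F -> slin G.
Proof. by move=> /funext->. Qed.

Lemma slot_def_ext (P Q : (nat -> nat -> nat) -> Prop) :
  (forall u, P u <-> Q u) -> sdef P -> sdef Q.
Proof. by move=> PQ; suff -> : P = Q by []; apply/funext => u; apply/propext. Qed.

Lemma slot_ler F G : slin F -> slin G -> sdef (fun u => F u <= G u).
Proof.
move=> lF lG; apply: slot_def_ext (slot_ge0 (slot_add lG (slot_opp lF))) => u.
by rewrite subr_ge0.
Qed.

Lemma slot_ltr F G : slin F -> slin G -> sdef (fun u => F u < G u).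
Proof.
move=> lF lG; apply: slot_def_ext (slot_not (slot_ler lG lF)) => u.
by rewrite ltNge; split=> /negP.
Qed.

Lemma slot_leq (f g : (nat -> nat -> nat) -> nat) :
  slin (fun u => (f u)%:R) -> slin (fun u => (g u)%:R) ->
  sdef (fun u => (f u <= g u)%N).
Proof. by move=> lf lg; apply: slot_def_ext (slot_ler lf lg) => u; rewrite ler_nat. Qed.

Lemma slot_ltn (f g : (nat -> nat -> nat) -> nat) :
  slin (fun u => (f u)%:R) -> slin (fun u => (g u)%:R) ->
  sdef (fun u => (f u < g u)%N).
Proof. by move=> lf lg; apply: slot_def_ext (slot_ltr lf lg) => u; rewrite ltr_nat. Qed.

Lemma slot_eqn (f g : (nat -> nat -> nat) -> nat) :
  slin (fun u => (f u)%:R) -> slin (fun u => (g u)%:R) ->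
  sdef (fun u => f u = g u).
Proof.
move=> lf lg; apply: slot_def_ext (slot_and (slot_leq lf lg) (slot_leq lg lf)) => u.
by split=> [[? ?]|->//]; apply/eqP; rewrite eqn_leq; apply/andP.
Qed.

Lemma slot_natc (c : nat) : slin (fun=> c%:R).
Proof. exact: (slot_const al B c). Qed.

Lemma slot_affine (f : (nat -> nat -> nat) -> nat) c d :
  slin (fun u => (f u)%:R) -> slin (fun u => (c * f u + d)%:R).
Proof.
move=> lf; elim: c => [|c IH]; first exact: slot_natc.
by apply: slot_lin_ext (slot_add lf IH) => u; rewrite -natrD mulSn addnA.
Qed.

Lemma slot_imp P Q : sdef P -> sdef Q -> sdef (fun u => P u -> Q u).
Proof.
move=> dP dQ; apply: slot_def_ext (slot_or (slot_not dP) dQ) => u.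
by split=> [[]//|h]; case: (pselect (P u)) => [/h|]; [right|left].
Qed.

Lemma slot_all m (P : nat -> (nat -> nat -> nat) -> Prop) :
  (forall i, (i < m)%N -> sdef (P i)) -> sdef (fun u => forall i, (i < m)%N -> P i u).
Proof.
elim: m => [|m IH] dP; first by apply: slot_def_ext (slot_leq (slot_natc 0) (slot_natc 0)) => u.
apply: slot_def_ext (slot_and (IH (fun i im => dP i (ltnW im))) (dP m (ltnSn m))) => u.
split=> [[h hm] i|h]; last by split=> [i im|]; apply: h => //; apply: ltnW.
by rewrite ltnS leq_eqVlt => /orP[/eqP->|/h].
Qed.

Lemma slot_rule P (s : nat -> (nat -> nat -> nat) -> nat) :
  rule_def P -> (forall i, slin (fun u => (s i u)%:R)) ->
  sdef (fun u => P (fun i => s i u)).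
Proof.
move=> dP ls; elim: dP => [i c j d|P1 P2 _ IP _ IQ|P1 P2 _ IP _ IQ|P1 P2 E _ IP].
- by apply: slot_eqn => //; apply: slot_affine.
- exact: slot_and.
- exact: slot_or.
- by apply: slot_def_ext IP => u; apply: E.
Qed.

(* Parameters: [p 1] = C0, [p 2] = bound on the coded numbers, [p 3] = e,
   [p (4 + j)] = N_j; [p 0] is the input.
   Lines: [o 0] = t, [o (2j + 1)] = n_j, [o (2j + 2)] = q_j. *)
Definition line (p o : nat -> nat) : Prop :=
  supports al (al ^+ 2) 4 (p 1%N) (fun j => p j.+4) (p 2%N) (p 3%N) (o 0%N)
    (fun j => o j.*2.+1) (fun j => o j.*2.+2).

Definition line_fact (o : nat -> nat) : fact := (o 2%N, (o 4%N, o 6%N, o 8%N)).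

Definition mk_line (t : nat) (n q : nat -> nat) (s : nat) : nat :=
  if s is s'.+1 then (if odd s' then q s'./2 else n s'./2) else t.

Lemma mk_lineE t n q p : line p (mk_line t n q) =
  supports al (al ^+ 2) 4 (p 1%N) (fun j => p j.+4) (p 2%N) (p 3%N) t n q.
Proof.
rewrite /line /=; congr (supports _ _ _ _ _ _ _ _ _ _); apply/funext => j.
  by rewrite odd_double doubleK.
by rewrite odd_double /= uphalf_double.
Qed.

(** [best] with its universal quantifier stripped: [m] is a possible refutation. [line_test] lets
    all its conditions share one [m], so a line costs a single universal variable. *)
Definition best_test (c n t m : nat) : Prop :=
  ((n <= t)%N /\ pa n <= pa c) /\ ((m <= t)%N -> pa m <= pa c -> pa m <= pa n).

Definition line_test (p o : nat -> nat) (m : nat) : Prop :=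
  best_test (p 1%N) (o 0%N) (o 0%N) m /\ forall j, (j < 4)%N ->
    best_test (p j.+4) (o j.*2.+1) (o 0%N) m /\
    ((pb (o j.*2.+1) - pb (o j.*2.+2) < pa (p 3%N) /\
      pb (o j.*2.+2) - pb (o j.*2.+1) < pa (p 3%N)) /\ (o j.*2.+2 <= p 2%N)%N).

Lemma line_testP p o : line p o <-> forall m, line_test p o m.
Proof.
split=> [[[b1 b2 b3] h] m|h].
  split=> [|j j4]; first by split; [split|apply: b3].
  have [[c1 c2 c3] + c4] := h j j4; rewrite ltr_norml => /andP[? ?].
  by split; [split; [split|apply: c3]|split=> //; split; lra].
split=> [|j j4].
  by have [[[h1 h2] _] _] := h 0%N; split=> // m; have [[_]] := h m.
have [_ /(_ j j4)[[[h1 h2] _] [[h3 h4] h5]]] := h 0%N.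
split=> //; last by rewrite ltr_norml; apply/andP; split; lra.
by split=> // m; have [_ /(_ j j4)[[_]]] := h m.
Qed.

Lemma slot_line_test b (f : nat -> nat) c : (b < 4)%N -> (c < 4)%N ->
  (forall s, (s < 9)%N -> (f s < B)%N) ->
  sdef (fun u => line_test (u 0%N) (fun s => u b (f s)) (u c 0%N)).
Proof.
move=> b4 c4 fB.
have best_def (v w x y : nat * nat) :
    [&& v.1 < 4, w.1 < 4, x.1 < 4 & y.1 < 4]%N -> [&& v.2 < B, w.2 < B, x.2 < B & y.2 < B]%N ->
    sdef (fun u => best_test (u v.1 v.2) (u w.1 w.2) (u x.1 x.2) (u y.1 y.2)).
  move=> /and4P[? ? ? ?] /and4P[? ? ? ?].
  apply: slot_and; first apply: slot_and.
  - by apply: slot_leq; apply: slot_nat.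
  - by apply: slot_ler; apply: slot_frac1.
  - apply: slot_imp; first by apply: slot_leq; apply: slot_nat.
    by apply: slot_imp; apply: slot_ler; apply: slot_frac1.
apply: slot_and.
  by apply: (best_def (0, 1) (b, f 0) (b, f 0) (c, 0))%N; rewrite /= ?b4 ?c4 ?fB.
apply: slot_all => j j4.
have f1 : (f j.*2.+1 < B)%N by apply: fB; lia.
have f2 : (f j.*2.+2 < B)%N by apply: fB; lia.
have j1 : (j.+4 < B)%N by lia.
apply: slot_and.
  by apply: (best_def (0, j.+4) (b, f j.*2.+1) (b, f 0) (c, 0))%N; rewrite /= ?b4 ?c4 ?f1 ?j1 ?fB.
apply: slot_and; last by apply: slot_leq; apply: slot_nat.
have l1 := slot_frac2 al b4 f1; have l2 := slot_frac2 al b4 f2.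
have l3 := slot_frac1 al (isT : (0 < 4)%N) (isT : (3 < B)%N).
by apply: slot_and; apply: slot_ltr l3; apply: slot_add (slot_opp _).
Qed.

(* In the third block, slot 0 holds a candidate refutation of the universally
   quantified line, and slots 5s + i + 1 hold entry s of the i-th premise
   (i < 4) and of the line with the goal (i = 4); hence 1 + 5 * 9 = 46 slots. *)
Definition sub_line (u : nat -> nat) (i : nat) : nat -> nat :=
  fun s => u (s * 5 + i).+1%N.

(** The assumption that [u 1] is a line occurs negatively, so its refuting number is existential and
    sits in block 2; the lines of block 2 occur positively, and their tests are universal and use
    block 3. The last conjunct provides the goal. *)
Definition sentence_matrix (P : (nat -> nat) -> Prop) (l : nat)
    (u : nat -> nat -> nat) : Prop :=
  (~ line_test (u 0%N) (u 1%N) (u 2%N 0%N) \/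
   (u 1%N 2%N = 0%N \/
    ((forall i, (i < 4)%N -> sub_line (u 2%N) i 2%N = 0%N \/
        ((sub_line (u 2%N) i 0%N < u 1%N 0%N)%N /\
         line_test (u 0%N) (sub_line (u 2%N) i) (u 3%N 0%N))) /\
     P (fact_env (line_fact (u 1%N)) (line_fact (sub_line (u 2%N) 0))
          (line_fact (sub_line (u 2%N) 1)) (line_fact (sub_line (u 2%N) 2))
          (line_fact (sub_line (u 2%N) 3)))))) /\
  (line_test (u 0%N) (sub_line (u 2%N) 4) (u 3%N 0%N) /\
   ((sub_line (u 2%N) 4 2%N = l /\ sub_line (u 2%N) 4 4%N = u 0%N 0%N) /\
    (sub_line (u 2%N) 4 6%N = 0%N /\ sub_line (u 2%N) 4 8%N = 0%N))).

Lemma slot_sentence P l : rule_def P -> sdef (sentence_matrix P l).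
Proof.
move=> dP.
have sl b i : (b < 4)%N -> (i < B)%N -> slin (fun u => (u b i)%:R) by exact: slot_nat.
have se b i b' i' : (b < 4)%N -> (i < B)%N -> (b' < 4)%N -> (i' < B)%N ->
    sdef (fun u => u b i = u b' i') by move=> *; apply: slot_eqn; apply: sl.
have sc b i c : (b < 4)%N -> (i < B)%N -> sdef (fun u => u b i = c).
  by move=> *; apply: slot_eqn; [apply: sl|apply: slot_natc].
apply: slot_and.
  apply: slot_or; first by apply: slot_not; apply: (@slot_line_test 1 id 2) => // s; lia.
  apply: slot_or; first exact: sc.
  apply: slot_and.
    apply: slot_all => i i4; apply: slot_or; first by apply: sc => //; lia.
    apply: slot_and; first by apply: slot_ltn; apply: sl => //; lia.
    by apply: (@slot_line_test 2 (fun s => (s * 5 + i).+1)%N 3) => // s; lia.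
  apply: (@slot_rule P (fun i u => fact_env (line_fact (u 1%N)) (line_fact (sub_line (u 2%N) 0))
          (line_fact (sub_line (u 2%N) 1)) (line_fact (sub_line (u 2%N) 2))
          (line_fact (sub_line (u 2%N) 3)) i)) => // i.
  do 20 (case: i => [|i]; first by apply: sl).
  by apply: slot_lin_ext (slot_natc 0) => u; rewrite /fact_env nth_default.
apply: slot_and.
  by apply: (@slot_line_test 2 (fun s => (s * 5 + 4).+1)%N 3) => // s; lia.
by do !apply: slot_and; [exact: sc|exact: se|exact: sc|exact: sc].
Qed.

(** * Derivations as finite sequences of facts *)

Definition justified (P : (nat -> nat) -> Prop) (prev : seq fact) (q : fact) : Prop :=
  q.1 = 0%N \/ exists a b c d, P (fact_env q a b c d) /\
    forall x, x \in [:: a; b; c; d] -> x.1 = 0%N \/ x \in prev.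

Definition derivation P (s : seq fact) : Prop := forall i, (i < size s)%N ->
  justified P (take i s) (nth (0, (0, 0, 0))%N s i).

Lemma justified_sub P s s' q : {subset s <= s'} -> justified P s q -> justified P s' q.
Proof.
move=> ss' [|[a [b [c [d [Pe h]]]]]]; first by left.
by right; exists a, b, c, d; split=> // x /h[|/ss']; [left|right].
Qed.

Lemma derivation_cat P s s' : derivation P s -> derivation P s' -> derivation P (s ++ s').
Proof.
move=> ds ds' i; rewrite size_cat nth_cat take_cat => h.
case: (ltnP i (size s)) => si; first exact: ds.
apply: justified_sub (ds' _ _); last by rewrite ltn_subLR.
by move=> x; rewrite mem_cat orbC => ->.
Qed.

Lemma derivation_rcons P s q : derivation P s -> justified P s q -> derivation P (rcons s q).
Proof.
move=> ds jq i; rewrite size_rcons ltnS nth_rcons -cats1 take_cat; case: ltngtP => // [h _|-> _].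
  exact: ds.
by rewrite subnn take0 cats0.
Qed.

(** A derivation tree is flattened by concatenating the sequences for its premises and appending its
    conclusion. *)
Lemma derives_derivation P q : derives P q -> exists2 s, derivation P s & q \in s.
Proof.
elim=> {q} [t|q a b c d Pe _ [sa da ma] _ [sb db mb] _ [sc dc mc] _ [sd dd md]].
  by exists [:: (0%N, t)]; rewrite ?mem_head// => -[|//] _; left.
exists (rcons (sa ++ sb ++ sc ++ sd) q); last by rewrite mem_rcons mem_head.
apply: derivation_rcons; first by do !apply: derivation_cat.
right; exists a, b, c, d; split=> // x; rewrite !inE => xin; right.
by rewrite !mem_cat; case/or4P: xin => /eqP->; rewrite ?ma ?mb ?mc ?md ?orbT.
Qed.

Hypothesis al_indep : lin_indep3 al (al ^+ 2).

(** The parameters may be arbitrary here: premises with a nonzero label have strictly smaller times,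
    so induction on the time derives the fact of every line. *)
Lemma sentence_sound P l n u0 : u0 0%N = n ->
  (forall u1, exists u2, forall u3, sentence_matrix P l (assign u0 u1 u2 u3)) ->
  derives P (l, (n, 0, 0))%N.
Proof.
move=> u0n H.
have derives0' q : q.1 = 0%N -> derives P q.
  by case: q => [l' t] /= ->; apply: derives0.
have main o : line u0 o -> derives P (line_fact o).
  have [t tk] := ubnP (o 0%N); elim: t o tk => // t IH o ot lo.
  have [u2 h] := H o; have [o0|o0] := eqVneq (o 2%N) 0%N; first exact: derives0'.
  have {}h u3 := (h u3).1.
  have {}h u3 : (forall i, (i < 4)%N -> sub_line u2 i 2%N = 0%N \/
        ((sub_line u2 i 0%N < o 0%N)%N /\ line_test u0 (sub_line u2 i) (u3 0%N))) /\
     P (fact_env (line_fact o) (line_fact (sub_line u2 0))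
          (line_fact (sub_line u2 1)) (line_fact (sub_line u2 2))
          (line_fact (sub_line u2 3))).
    case: (h u3) => [[]|[e|//]]; first exact: ((line_testP _ _).1 lo).
    by move: o0; rewrite [o 2%N]e.
  have dsub i : (i < 4)%N -> derives P (line_fact (sub_line u2 i)).
    move=> i4; have [e0|e0] := eqVneq (sub_line u2 i 2%N) 0%N; first exact: derives0'.
    (* [u2] is chosen before [u3], so constant functions [u3] test the same line against every
       [m]. *)
    have {}h m : (sub_line u2 i 0%N < o 0%N)%N /\ line_test u0 (sub_line u2 i) m.
      by have [/(_ i i4)[e|//] _] := h (fun=> m); rewrite e in e0.
    apply: IH; first by have [h1 _] := h 0%N; apply: leq_trans h1 _.
    by apply/line_testP => m; have [] := h m.
  by have [_ Pe] := h (fun=> 0%N); apply: derives_rule Pe _ _ _ _; apply: dsub.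
have [u2 h] := H (fun=> 0%N).
have {}h u3 := (h u3).2.
have lo : line u0 (sub_line u2 4) by apply/line_testP => m; have [] := h (fun=> m).
have [_ [[e1 e2] [e3 e4]]] := h (fun=> 0%N).
have := main _ lo; rewrite /line_fact.
by move: e1 e2 e3 e4; rewrite /= u0n => -> -> -> ->.
Qed.

Lemma sentence_complete P l n : derives P (l, (n, 0, 0))%N ->
  exists u0, u0 0%N = n /\
    forall u1, exists u2, forall u3, sentence_matrix P l (assign u0 u1 u2 u3).
Proof.
move=> /derives_derivation[s0 ds0 ms0].
(* The prepended fact holds by convention and meets the requirement that a coded sequence start with
   zeros. *)
pose z : fact := (0, (0, 0, 0))%N; pose s := z :: s0.
have ds : derivation P s.
  by rewrite -[s]/([:: z] ++ s0); apply: derivation_cat => // -[|//] _; left.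
pose w i j := nth 0%N (fact_seq (nth z s i)) j.
have w0 j : w 0%N j = 0%N by do 4 (case: j => [//|j]); rewrite /w nth_default.
have [C0 [N [Bd [e [tm [tmS lines only]]]]]] := coding al_indep 4 (size s0) w0.
pose u0 i := match i with 0 => n | 1 => C0 | 2 => Bd | 3 => e | j.+4 => N j end%N.
have tm_mono i i' : (i < i')%N -> (i' <= size s0)%N -> (tm i < tm i')%N.
  elim: i' => // i' IH; rewrite ltnS leq_eqVlt => /orP[/eqP->|ii'] i's; first exact: tmS.
  exact: ltn_trans (IH ii' (ltnW i's)) (tmS _ i's).
have w_fact i : (w i 0%N, (w i 1%N, w i 2%N, w i 3%N)) = nth z s i.
  by rewrite /w; case: (nth z s i) => [? [[? ?] ?]].
have line_of i : (i <= size s0)%N -> exists o,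
    [/\ line u0 o, o 0%N = tm i & line_fact o = nth z s i].
  move=> iK; have [nn h] := lines i iK.
  by exists (mk_line (tm i) nn (w i)); rewrite mk_lineE /line_fact /= w_fact.
have [r [lr _ fr]] : exists r, [/\ line u0 r, True & line_fact r = (l, (n, 0, 0))%N].
  have /(nthP z)[i ilt ie] := ms0.
  by have [r [? _ E]] := line_of i.+1 ilt; exists r; rewrite E.
(* [pr] exhibits a premise found before index [x.2]. A premise labelled 0 need not be a line of the
   code. *)
have /choice[pr prP] : forall x : fact * nat, exists o : nat -> nat,
    (x.1.1 = 0%N \/ exists2 i, (i < x.2)%N & (i <= size s0)%N /\ nth z s i = x.1) ->
    line_fact o = x.1 /\
    (o 2%N = 0%N \/ (line u0 o /\ exists2 i, (i < x.2)%N & o 0%N = tm i)).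
  move=> [x i]; have [[x0|[i' i'i [i'K E]]]|no] := pselect
      (x.1 = 0%N \/ exists2 i', (i' < i)%N & (i' <= size s0)%N /\ nth z s i' = x).
  - exists (mk_line 0 (fun=> 0%N) (fun j => nth 0%N (fact_seq x) j)) => _.
    split; last by left.
    by rewrite /line_fact /=; case: (x) => [? [[? ?] ?]].
  - have [o [lo o0 fo]] := line_of i' i'K; exists o => _; split; first by rewrite fo.
    by right; split=> //; exists i'.
  - by exists (fun=> 0%N) => /no.
pose join m (o : nat -> nat -> nat) (k : nat) :=
  if k is k'.+1 then o (k' %% 5)%N (k' %/ 5)%N else m.
have joinE m o i : (i < 5)%N -> sub_line (join m o) i = o i.
  move=> i5; apply/funext => k; rewrite /sub_line /join.
  by rewrite modnMDl modn_small// divnMDl// divn_small// addn0.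
exists u0; split=> // u1.
have root u3 m o : o 4%N = r ->
    let u := assign u0 u1 (join m o) u3 in
    line_test (u 0%N) (sub_line (u 2%N) 4) (u 3%N 0%N) /\
   ((sub_line (u 2%N) 4 2%N = l /\ sub_line (u 2%N) 4 4%N = u 0%N 0%N) /\
    (sub_line (u 2%N) 4 6%N = 0%N /\ sub_line (u 2%N) 4 8%N = 0%N)).
  move=> o4; rewrite /= joinE// o4; split; first exact: (line_testP _ _).1.
  by case: fr => -> -> -> ->.
(* If [u1] is not a line, slot 0 of the third block names a number refuting it. If it is, [only]
   identifies it with an entry of the sequence. *)
have [lu1|/line_testP nl] := pselect (line u0 u1); last first.
  have [m nm] : exists m, ~ line_test u0 u1 m by apply/existsNP.
  by exists (join m (fun=> r)) => u3; split; [left|exact: root].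
have [i [iK ti qi]] := only _ _ _ lu1.
have fu1 : line_fact u1 = nth z s i by rewrite -w_fact /line_fact -!qi.
have [q0|[a [b [c [d [Pe prem]]]]]] := ds i iK.
  exists (join 0%N (fun=> r)) => u3; split; last exact: root.
  by right; left; rewrite -fu1 in q0.
pose o j := if (j < 4)%N then pr (nth z [:: a; b; c; d] j, i) else r.
have oP j : (j < 4)%N -> line_fact (o j) = nth z [:: a; b; c; d] j /\
    (o j 2%N = 0%N \/ (line u0 (o j) /\ exists2 i', (i' < i)%N & o j 0%N = tm i')).
  move=> j4; rewrite /o j4; apply: (prP (_, i)).
  have [|h|/(nthP z)[i' i'lt E]] := prem (nth z [:: a; b; c; d] j); first exact: mem_nth.
    by left.
  have i'i : (i' < i)%N by apply: leq_trans i'lt _; rewrite size_take_min geq_minl.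
  by right; exists i' => //; split; [apply: leq_trans (ltnW i'i) iK|rewrite -E nth_take].
exists (join 0%N o) => u3; split; last by apply: root; rewrite /o.
right; right; split=> [j j4|].
  rewrite /= joinE ?(leq_trans j4)//.
  have [_ [->|[lo [i' i'i ->]]]] := oP j j4; first by left.
  by right; split; [rewrite ti tm_mono|exact: (line_testP _ _).1].
by rewrite /= !joinE// fu1 (oP 0%N isT).1 (oP 1%N isT).1 (oP 2%N isT).1 (oP 3%N isT).1.
Qed.

End Sentence.

(** * Diagonalization *)

Lemma computes_fun n (f : recfun n) v y z : computes f v y -> computes f v z -> y = z.
Proof.
elim: f v y z => {n} [||n i|m n f IHf g IHg|n f IHf g IHg|n f IHf] v y z /=.
- by move=> -> ->.
- by move=> -> ->.
- by move=> -> ->.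
- move=> [w [gw fw]] [w' [gw' fw']].
  have E : w = w' by apply: eq_from_tnth => i; apply: IHg (gw i) (gw' i).
  by rewrite -E in fw'; apply: IHf fw fw'.
- elim: (thead v) y z => [|t IH] y z; first exact: IHf.
  move=> [y' [y1 y2]] [z' [z1 z2]]; rewrite (IH _ _ y1 z1) in y2.
  exact: IHg y2 z2.
move=> [y1 y2] [z1 z2]; case: (ltngtP y z) => // h.
  by have [u /(IHf _ _ _ y1)] := z2 y h.
by have [u /(IHf _ _ _ z1)] := y2 z h.
Qed.

Lemma computes_comp1 n (f : recfun 1) (g : recfun n) v c :
  (forall y, computes g v y <-> y = c) ->
  forall y, computes (Comp f (fun=> g)) v y <-> computes f [tuple c] y.
Proof.
move=> gc y; split=> [[w [gw fw]]|fc]; last first.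
  by exists [tuple c]; split=> // i; apply/gc; rewrite ord1.
suff -> : [tuple c] = w by [].
by apply: eq_from_tnth => i; rewrite ord1 ((gc _).1 (gw ord0)).
Qed.

Lemma computes_comp2 n (f : recfun 2) (g h : recfun n) v c e :
  (forall y, computes g v y <-> y = c) -> (forall y, computes h v y <-> y = e) ->
  forall y, computes (Comp f (fun i => if i == ord0 then g else h)) v y <->
            computes f [tuple c; e] y.
Proof.
move=> gc he y; split=> [[w [gw fw]]|fc]; last first.
  exists [tuple c; e]; split=> // -[[|[|//]] i] /=; first exact/gc.
  exact/he.
suff -> : [tuple c; e] = w by [].
apply: eq_from_tnth => -[[|[|//]] i2].
  by have /= /gc := gw (Ordinal i2); rewrite !(tnth_nth 0%N).
by have /= /he := gw (Ordinal i2); rewrite !(tnth_nth 0%N).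
Qed.

Lemma computes_primrec n (f : recfun n) (g : recfun n.+2) v c (h : nat -> nat -> nat) :
  (forall z, computes f v z <-> z = c) ->
  (forall t z' z, computes g [tuple of t :: z' :: v] z <-> z = h t z') ->
  forall t z, computes (PrimRec f g) [tuple of t :: v] z <->
              z = nat_rect (fun=> nat) c h t.
Proof.
have fixE (p : n.-tuple nat) : (forall z, computes f p z <-> z = c) ->
    (forall t z' z, computes g [tuple of t :: z' :: p] z <-> z = h t z') ->
    forall t z, (fix iterate (t z : nat) : Prop := match t with
         | 0%N => computes f p z
         | t'.+1 => exists z', iterate t' z' /\ computes g [tuple of t' :: z' :: p] z
         end) t z <-> z = nat_rect (fun=> nat) c h t.
  move=> fc gh; elim=> [|t IH] z; first exact: fc.
  split=> [[z' [/IH -> /gh//]]|->].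
  by exists (nat_rect (fun=> nat) c h t); split; [apply/IH|apply/gh].
move=> fc gh t z; apply: (fixE [tuple of behead [tuple of t :: v]]).
  by have -> : [tuple of behead [tuple of t :: v]] = v by apply: val_inj.
by have -> : [tuple of behead [tuple of t :: v]] = v by apply: val_inj.
Qed.

(** * Computability of the code of the input formula *)

Definition computable (F : nat -> nat) : Prop :=
  exists f : recfun 1, forall n y, computes f [tuple n] y <-> y = F n.

Lemma computable_id : computable id.
Proof. by exists (Proj ord0). Qed.

Lemma computable_const c : computable (fun=> c).
Proof.
elim: c => [|c [f fc]].
  exists (Comp Zero (fun _ : 'I_0 => Proj ord0)) => n y.
  by split=> [[w []]|->] //; exists [tuple]; split=> // -[].
exists (Comp Succ (fun=> f)) => n y.
by rewrite (computes_comp1 _ (fc n)).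
Qed.

Lemma computable_double F : computable F -> computable (fun n => (F n).*2).
Proof.
move=> [f fF].
pose succ2 : recfun 2 := Comp Succ (fun=> Comp Succ (fun=> Proj (lift ord0 ord0))).
have dbl n y : computes (PrimRec Zero succ2) [tuple of n :: [tuple]] y <-> y = n.*2.
  rewrite (@computes_primrec _ _ _ [tuple] 0%N (fun _ z => z.+2)) //.
  move=> t z' z.
  have p1 y' : computes (Proj (lift ord0 ord0)) [tuple of t :: z' :: [tuple]] y' <-> y' = z'.
    by [].
  have p2 y' : computes (Comp Succ (fun=> Proj (lift ord0 ord0))) [tuple of t :: z' :: [tuple]] y'
      <-> y' = z'.+1.
    by rewrite (computes_comp1 _ p1).
  by rewrite (computes_comp1 _ p2).
exists (Comp (PrimRec Zero succ2) (fun=> f)) => n y.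
rewrite (computes_comp1 _ (fF n)) -dbl.
by have -> : [tuple F n] = [tuple of F n :: [tuple]] by apply: val_inj.
Qed.

Lemma computable_cons F G :
  computable F -> computable G -> computable (fun n => code_cons (F n) (G n)).
Proof.
move=> [f fF] [g gG].
have [dbl dblE] := computable_double computable_id.
have [base baseE] : exists base : recfun 1, forall n y, computes base [tuple n] y <-> y = n.*2.+1.
  by exists (Comp Succ (fun=> dbl)) => n y; rewrite (computes_comp1 _ (dblE n)).
pose step : recfun 3 := Comp dbl (fun=> Proj (lift ord0 ord0)).
have consE a b y : computes (PrimRec base step) [tuple of a :: [tuple b]] y <-> y = code_cons a b.
  rewrite (@computes_primrec _ _ _ [tuple b] (b.*2.+1) (fun _ z => z.*2)) //.
    have -> : code_cons a b = nat_rect (fun=> nat) b.*2.+1 (fun _ z => z.*2) a; last by [].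
    rewrite /code_cons; elim: a => [|a /= <-]; first by rewrite expn0 mul1n.
    by rewrite expnS -mulnA mul2n.
  move=> t z' z.
  have p1 y' : computes (Proj (lift ord0 ord0)) [tuple of t :: z' :: [tuple b]] y' <-> y' = z'.
    by [].
  by rewrite (computes_comp1 _ p1) dblE.
exists (Comp (PrimRec base step) (fun i => if i == ord0 then f else g)) => n y.
rewrite (computes_comp2 _ (fF n) (gG n)) -consE.
by have -> : [tuple F n; G n] = [tuple of F n :: [tuple G n]] by apply: val_inj.
Qed.

Lemma code_input_computable d n : (0 < d)%N ->
  exists2 F, computable F & forall m, code_formula (input_formula d n m) = F m.
Proof.
case: d => // d _.
pose zeros := CodeSeq.code [seq 0%N | i <- enum 'I_d].
pose tail : nat := CodeSeq.code (map (@code_zalpha d.+1)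
  [tuple zalpha_mon d.+1 0 (if i == 0%N :> nat then -1 else 0) | i < n]).
pose L m := code_cons (code_cons m.*2 zeros) tail.
have cL : computable L.
  apply: computable_cons (computable_const _).
  exact: computable_cons (computable_double computable_id) (computable_const _).
have LE (m : nat) : code_linform (lin_form d.+1 n 0 0 (-1) m) = L m.
  rewrite /code_linform [LHS]/=; congr code_cons.
  rewrite /code_zalpha /= enum_ordSl /= -!map_comp; congr code_cons.
  by congr CodeSeq.code; rewrite [in RHS]enumT; apply: eq_map.
(* The tags 3, 0, 2, 1 stand for [And], [Ge0], [Not], [Gt0]. Within the code, [m] occurs only in
   [L m], as the constant term [m.*2]. *)
exists (fun m => code_cons 3 (code_cons (code_cons 0 (code_cons (L m) 0))
  (code_cons (code_cons 2 (code_cons (code_cons 1 (code_cons (L m) 0)) 0)) 0))).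
  by do ?[exact: computable_const|exact: cL|apply: computable_cons].
by move=> m; rewrite -LE.
Qed.

(** * Linear independence of 1, alpha and its square *)

(** A relation with [z] nonzero is a quadratic polynomial vanishing at [alpha]. It is irreducible,
    since a rational root would make the other root rational too and [alpha] is one of them. *)
Lemma quadratic_lin_indep (R : realType) (alpha : R) :
  irrational alpha -> ~ quadratic alpha -> lin_indep3 alpha (alpha ^+ 2).
Proof.
move=> irr nquad x y z rel.
have {}irr q : alpha <> ratr q by move=> aq; apply: irr; exists q.
have z0 : z = 0.
  apply/eqP/negPn/negP => z0; apply: nquad.
  pose p : {poly int} := Poly [:: x; y; z].
  have pE (S : comNzRingType) (f : {rmorphism int -> S}) (c : S) :
      (map_poly f p).[c] = f x + f y * c + f z * c ^+ 2.
    by rewrite map_Poly_id0 ?rmorph0// horner_Poly /=; ring.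
  have szp : size p = 3 by rewrite (PolyK (c := 0)).
  exists p; split=> //; last by rewrite /root pE rel.
  apply: cubic_irreducible => [|q].
    by rewrite size_map_inj_poly ?szp//; apply: intr_inj.
  apply/negP => /rootP; rewrite pE => relq.
  have zR : z%:~R != 0 :> R by rewrite intr_eq0.
  have relq' : x%:~R + y%:~R * ratr q + z%:~R * ratr q ^+ 2 = 0 :> R.
    have := congr1 (ratr : rat -> R) relq.
    by rewrite !(rmorphD, rmorphM, rmorphXn) /= !ratr_int rmorph0.
  have : (alpha - ratr q) * (z%:~R * (alpha + ratr q) + y%:~R) = 0.
    by rewrite -[RHS](subrr 0) -{1}rel -relq'; ring.
  move/eqP; rewrite mulf_eq0 subr_eq0 => /orP[/eqP|/eqP E]; first exact: irr.
  apply: (irr (- (y%:~R / z%:~R) - q)).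
  rewrite rmorphB rmorphN fmorph_div /= !ratr_int.
  by apply: (mulfI zR); rewrite mulrBr mulrN mulrCA divff// mulr1; lra.
move: rel; rewrite z0 mul0r addr0 => rel.
have y0 : y = 0.
  apply/eqP/negPn/negP => y0; apply: (irr (- (x%:~R / y%:~R))).
  have yR : y%:~R != 0 :> R by rewrite intr_eq0.
  rewrite rmorphN fmorph_div /= !ratr_int.
  by apply: (mulfI yR); rewrite mulrN mulrCA divff// mulr1; lra.
by move: rel; rewrite y0 mul0r addr0 => /eqP; rewrite intr_eq0 => /eqP.
Qed.

(** Degree 0 is impossible for an irreducible polynomial, degree 1 would relate 1 and [alpha]
    linearly, and degree 2 is excluded. *)
Lemma degree_gt2 (R : realType) (alpha : R) d :
  algebraic_of_degree alpha d -> irrational alpha -> ~ quadratic alpha -> (2 < d)%N.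
Proof.
move=> alg irr nquad; have indep := quadratic_lin_indep irr nquad.
case: d alg => [|[|[|//]]] alg; last by case: nquad.
  case: alg => p [sp [+ _] _]; rewrite size_map_inj_poly ?sp//; exact: intr_inj.
case: alg => p [sp _ /rootP]; rewrite horner_coef size_map_inj_poly ?sp//; last exact: intr_inj.
rewrite !big_ord_recl big_ord0 /= !coef_map /= expr0 expr1 mulr1 addr0 => rel.
have [|_ p1 _] := indep p`_0 p`_1 0; first by rewrite mul0r addr0.
have : lead_coef p = 0 by rewrite lead_coefE sp.
by move/eqP; rewrite lead_coef_eq0 -size_poly_eq0 sp.
Qed.

(** Each block holds 46 slots of three integer variables, whence 138. *)
Lemma undecidable_EAEA (R : realType) (alpha : R) (d k : nat) :
  (2 < d)%N -> (138 <= k)%N -> lin_indep3 alpha (alpha ^+ 2) ->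
  ~ algorithmically_decidable (@code_EAEA d k) (@EAEA_true R alpha d k).
Proof.
move=> d3 k138 indep [f fP].
have [F [h hE] FE] := code_input_computable (sumn (nseq 4 k)) (ltnW (ltnW d3)).
(* [g] sends the code of a matrix to the code of its conjunction with the input formula for that
   same code. *)
have [g gE] : computable (fun n => code_cons 3 (code_cons (F n) (code_cons n 0))).
  do ?[exact: computable_const|exact: computable_id|apply: computable_cons].
  by exists h.
have [P [l [dP PE]]] := computes_rule (Comp f (fun=> g)).
have [phi phiE] := EAEA_slots d3 (k138 : (3 * 46 <= k)%N) isT (slot_sentence alpha l dP).
pose m := code_EAEA phi; pose S : EAEA_sentence d k := And (input_formula d _ m) phi.
have codeS : code_EAEA S = code_cons 3 (code_cons (F m) (code_cons m 0)).
  by rewrite -FE.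
have SE : EAEA_true alpha S <-> computes f [tuple code_EAEA S] 0%N.
  rewrite codeS -(computes_comp1 _ (gE m)) -PE phiE; split.
    by move=> [u0 [u0m H]]; apply: sentence_sound u0m H.
  exact: sentence_complete.
have [fT fF] := fP S.
have [T|nT] := pselect (EAEA_true alpha S); last by apply: (nT); apply/SE/fF.
by have := computes_fun (fT T) (SE.1 T).
Qed.

Theorem theorem1p5 (R : realType) (alpha : R) (d : nat)
    (alpha_alg : algebraic_of_degree alpha d)
    (alpha_irr : irrational alpha)
    (alpha_nquad : ~ quadratic alpha) :
  ~ algorithmically_decidable (@code_EAEA d 20000)
      (@EAEA_true R alpha d 20000).
Proof.
apply: undecidable_EAEA (degree_gt2 alpha_alg alpha_irr alpha_nquad) _ _.
  by [].
exact: quadratic_lin_indep.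
Qed.
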